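(* Let $\mathbf S$ be a category with finite products and let $\mathscr C$ be an $\mathbf S$-indexed symmetric monoidal category with indexed homotopy coproducts preserved by $\otimes$. For any $A\in\mathbf S$, an object $M\in\mathscr C^A$ is dualizable in the symmetric monoidal category $\mathscr C^A$ if and only if the 1-cell $\widehat M\colon A\to\star$ is right dualizable in the bicategory $\mathscr C/_{\mathbf S}$. Moreover, in this case the right dual of $\widehat M$ is the 1-cell $\star\to A$ corresponding to the dual of $M$: $(\widehat M)^\bigstar\cong\check{(M^\bigstar)}$.
   Context: **Indexed categories.** $\star$ is the terminal object of $\mathbf S$, $\pi_A\colon A\to\star$ the unique map and $\Delta_A\colon A\to A\times A$ the diagonal; canonical isomorphisms such as $A\times\star\cong A$ are suppressed. An $\mathbf S$-indexed symmetric monoidal category $\mathscr C$ is a pseudofunctor from $\mathbf S^{\mathrm{op}}$ to the 2-category of symmetric monoidal categories, strong symmetric monoidal functors and monoidal natural transformations; its value at $A$ is $(\mathscr C^A,\otimes_A,I_A)$ and its value at $f\colon A\to B$ is the reindexing functor $f^*\colon\mathscr C^B\to\mathscr C^A$. For $M\in\mathscr C^A$, $N\in\mathscr C^B$ the external product is $M\boxtimes N=(\mathrm{id}_A\times\pi_B)^*M\otimes_{A\times B}(\pi_A\times\mathrm{id}_B)^*N\in\mathscr C^{A\times B}$, and $U=I_\star$. There are canonical isomorphisms $M\otimes_AN\cong\Delta_A^*(M\boxtimes N)$, $I_A\cong\pi_A^*U$, $f^*M\boxtimes g^*N\cong(f\times g)^*(M\boxtimes N)$. **Indexed homotopy coproducts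 preserved by $\otimes$** means: each $f^*$ has a left adjoint $f_!$; for each square in a class of commutative squares of $\mathbf S$ called homotopy pullback squares, with top $f\colon A\to B$, left $h\colon A\to C$, right $g\colon B\to D$, bottom $k\colon C\to D$, the Beck-Chevalley morphism $f_!h^*\to f_!h^*k^*k_!\cong f_!f^*g^*k_!\to g^*k_!$ is an isomorphism; and for $f\colon A\to B$, $M\in\mathscr C^B$, $N\in\mathscr C^A$ the canonical map $f_!(f^*M\otimes N)\to f_!(f^*M\otimes f^*f_!N)\cong f_!f^*(M\otimes f_!N)\to M\otimes f_!N$ is an isomorphism (equivalently, the canonical maps $(f\times g)_!(M\boxtimes N)\to f_!M\boxtimes g_!N$ are isomorphisms). The class of homotopy pullback squares depends on the situation; it is only assumed to contain the following squares, their transposes, and all squares obtained from these by cartesian product with a fixed object: (a) top $f\times\mathrm{id}_C\colon A\times C\to B\times C$, left $\mathrm{id}_A\times g\colon A\times C\to A\times D$, right $\mathrm{id}_B\times g$, bottom $f\times\mathrm{id}_D$; (b) top and left $\Delta_A\colon A\to A\times A$, right $\mathrm{id}_A\times\Delta_A$, bottom $\Delta_A\times\mathrm{id}_A\colon A\times A\to A\times A\times A$; (c) for $f\colon A\to B$: top $(\mathrm{id}_A,f)\colon A\to A\times B$, left $f\colon A\to B$, right $f\times\mathrm{id}_B$, bottom $\Delta_B$. The square with top and left $\mathrm{id}_A$ and right and bottom $\Delta_A$ is not assumed to belong to it. **The bicategory $\mathscr C/_{\mathbf S}$** has the objects of $\mathbf S$ as 0-cells and hom-categories $\mathscr C/_{\mathbf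 S}(A,B)=\mathscr C^{A\times B}$. For 1-cells $M\colon A\to B$, $N\colon B\to C$, $M\odot N=(\mathrm{id}_A\times\pi_B\times\mathrm{id}_C)_!(\mathrm{id}_A\times\Delta_B\times\mathrm{id}_C)^*(M\boxtimes N)\colon A\to C$; units are $U_A=(\Delta_A)_!\pi_A^*U\cong(\Delta_A)_!I_A$. The associator identifies both bracketings of a triple composite, via pseudofunctoriality, compatibility of $\boxtimes$ with reindexing and pushforward, and Beck-Chevalley for (a), with $(\mathrm{id}_A\times\pi_B\times\pi_C\times\mathrm{id}_D)_!(\mathrm{id}_A\times\Delta_B\times\Delta_C\times\mathrm{id}_D)^*(M\boxtimes N\boxtimes P)$. The right unitor is $M\odot U_B\cong(\mathrm{id}_A\times\pi_B\times\mathrm{id}_B)_!(\mathrm{id}_A\times\Delta_B)_!(\mathrm{id}_A\times\Delta_B)^*(\mathrm{id}_A\times\mathrm{id}_B\times\pi_B)^*(M\boxtimes U)\cong M$, by Beck-Chevalley for (b) and $(\pi\times\mathrm{id})\Delta=\mathrm{id}=(\mathrm{id}\times\pi)\Delta$; the left unitor is analogous. **Duality.** An object $M$ of a symmetric monoidal category is dualizable, with dual $M^\bigstar$, if there are $\eta\colon I\to M\otimes M^\bigstar$, $\epsilon\colon M^\bigstar\otimes M\to I$ satisfying the triangle identities. A 1-cell $M\colon R\to S$ of a bicategory is right dualizable, with right dual $M^\bigstar\colon S\to R$, if there are 2-cells $\eta\colon U_R\to M\odot M^\bigstar$, $\epsilon\colon M^\bigstar\odot M\to U_S$ satisfying the triangle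 identities. **Hats and checks.** For $M\in\mathscr C^A$, $\widehat M\colon A\to\star$ and $\check M\colon\star\to A$ denote $M$ regarded as 1-cells of $\mathscr C/_{\mathbf S}$ via $A\times\star\cong A\cong\star\times A$. *)

(* Defs.v *)
From Corelib Require Import ssreflect.

Set Implicit Arguments.
Unset Strict Implicit.
Unset Printing Implicit Defensive.

Record category := Category {
  ob :> Type;
  hom : ob -> ob -> Type;
  idm : forall x, hom x x;
  comp : forall x y z, hom y z -> hom x y -> hom x z;
  comp_idl : forall x y (f : hom x y), comp (idm y) f = f;
  comp_idr : forall x y (f : hom x y), comp f (idm x) = f;
  compA : forall w x y z (h : hom y z) (g : hom x y) (f : hom w x),
    comp h (comp g f) = comp (comp h g) f
}.

Declare Scope cat_scope.
Delimit Scope cat_scope with cat.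
Local Open Scope cat_scope.

Notation "x ~> y" := (hom x y) (at level 70, no associativity) : cat_scope.
Notation "g \o f" := (comp g f) (at level 40, left associativity) : cat_scope.

(* An inverse is unique when it exists, so keeping it as data (in Type)
   adds nothing to the statement that [f] is an isomorphism. *)
Record is_iso (C : category) (x y : C) (f : x ~> y) := IsIso {
  inv : y ~> x;
  inv_comp : inv \o f = idm x;
  comp_inv : f \o inv = idm y
}.

Record iso (C : category) (x y : C) := Iso {
  fwd :> x ~> y;
  bwd : y ~> x;
  bwd_fwd : bwd \o fwd = idm x;
  fwd_bwd : fwd \o bwd = idm y
}.

Definition iso_of (C : category) (x y : C) (f : x ~> y) (i : is_iso f) :
  iso x y := Iso (inv_comp i) (comp_inv i).

Definition iso_id (C : category) (x : C) : iso x x :=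
  Iso (comp_idl (idm x)) (comp_idl (idm x)).

Definition iso_inv (C : category) (x y : C) (i : iso x y) : iso y x :=
  Iso (fwd_bwd i) (bwd_fwd i).

Lemma comp_cancel (C : category) (x y z : C) (f : x ~> y) (f' : y ~> x)
  (g : y ~> z) (g' : z ~> y) :
  f' \o f = idm x -> g' \o g = idm y -> (f' \o g') \o (g \o f) = idm x.
Proof.
by move=> Hf Hg; rewrite compA -(compA f') Hg comp_idr Hf.
Qed.

(* diagrammatic order: first [i], then [j] *)
Definition iso_comp (C : category) (x y z : C) (i : iso x y) (j : iso y z) :
  iso x z :=
  @Iso C x z (j \o i) (bwd i \o bwd j)
    (comp_cancel (bwd_fwd i) (bwd_fwd j))
    (comp_cancel (fwd_bwd j) (fwd_bwd i)).

Notation "i >>> j" := (iso_comp i j) (at level 41, right associativity)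
  : cat_scope.

Definition iso_eq (I : Type) (C : category) (F : I -> C) (i j : I)
  (e : i = j) : iso (F i) (F j) :=
  match e in _ = k return iso (F i) (F k) with eq_refl => iso_id (F i) end.

Record functor (C D : category) := Functor {
  fobj :> C -> D;
  fmap : forall x y, (x ~> y) -> (fobj x ~> fobj y);
  fmap_id : forall x, fmap (idm x) = idm (fobj x);
  fmap_comp : forall x y z (g : y ~> z) (f : x ~> y),
    fmap (g \o f) = fmap g \o fmap f
}.

Lemma fmap_cancel (C D : category) (F : functor C D) (x y : C)
  (f : x ~> y) (g : y ~> x) : g \o f = idm x -> fmap F g \o fmap F f = idm (F x).
Proof. by move=> H; rewrite -fmap_comp H fmap_id. Qed.

Definition iso_map (C D : category) (F : functor C D) (x y : C)
  (i : iso x y) : iso (F x) (F y) :=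
  Iso (fmap_cancel F (bwd_fwd i)) (fmap_cancel F (fwd_bwd i)).

Definition fun_id (C : category) : functor C C :=
  @Functor C C (fun x => x) (fun x y f => f)
    (fun x => eq_refl) (fun x y z g f => eq_refl).

Lemma fun_comp_id (C D E : category) (G : functor D E) (F : functor C D) x :
  fmap G (fmap F (idm x)) = idm (G (F x)).
Proof. by rewrite !fmap_id. Qed.

Lemma fun_comp_comp (C D E : category) (G : functor D E) (F : functor C D)
  x y z (g : y ~> z) (f : x ~> y) :
  fmap G (fmap F (g \o f)) = fmap G (fmap F g) \o fmap G (fmap F f).
Proof. by rewrite !fmap_comp. Qed.

Definition fun_comp (C D E : category) (G : functor D E) (F : functor C D) :
  functor C E :=
  @Functor C E (fun x => G (F x)) (fun x y f => fmap G (fmap F f))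
    (fun_comp_id G F) (@fun_comp_comp C D E G F).

Record adjunction (C D : category) (L : functor C D) (R : functor D C) :=
  Adjunction {
  aunit : forall x, x ~> R (L x);
  acounit : forall y, L (R y) ~> y;
  aunit_nat : forall x x' (f : x ~> x'),
    aunit x' \o f = fmap R (fmap L f) \o aunit x;
  acounit_nat : forall y y' (g : y ~> y'),
    g \o acounit y = acounit y' \o fmap L (fmap R g);
  adj_triL : forall x, acounit (L x) \o fmap L (aunit x) = idm (L x);
  adj_triR : forall y, fmap R (acounit y) \o aunit (R y) = idm (R y)
}.

Record smcat := SMCat {
  smc_cat :> category;
  tens : smc_cat -> smc_cat -> smc_cat;
  tmap : forall x x' y y' : smc_cat,
    (x ~> x') -> (y ~> y') -> (tens x y ~> tens x' y');
  tunit : smc_cat;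
  tassoc : forall x y z, iso (tens (tens x y) z) (tens x (tens y z));
  tlunit : forall x, iso (tens tunit x) x;
  trunit : forall x, iso (tens x tunit) x;
  tbraid : forall x y, tens x y ~> tens y x;
  tmap_id : forall x y, tmap (idm x) (idm y) = idm (tens x y);
  tmap_comp : forall x x' x'' y y' y'' (f' : x' ~> x'') (f : x ~> x')
    (g' : y' ~> y'') (g : y ~> y'),
    tmap (f' \o f) (g' \o g) = tmap f' g' \o tmap f g;
  tassoc_nat : forall x x' y y' z z' (f : x ~> x') (g : y ~> y') (h : z ~> z'),
    tassoc x' y' z' \o tmap (tmap f g) h =
    tmap f (tmap g h) \o tassoc x y z;
  tlunit_nat : forall x x' (f : x ~> x'),
    tlunit x' \o tmap (idm tunit) f = f \o tlunit x;
  trunit_nat : forall x x' (f : x ~> x'),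
    trunit x' \o tmap f (idm tunit) = f \o trunit x;
  tbraid_nat : forall x x' y y' (f : x ~> x') (g : y ~> y'),
    tbraid x' y' \o tmap f g = tmap g f \o tbraid x y;
  tens_pentagon : forall w x y z,
    tassoc w x (tens y z) \o tassoc (tens w x) y z =
    tmap (idm w) (tassoc x y z) \o tassoc w (tens x y) z
      \o tmap (tassoc w x y) (idm z);
  tens_triangle : forall x y,
    tmap (idm x) (tlunit y) \o tassoc x tunit y = tmap (trunit x) (idm y);
  tens_hexagon : forall x y z,
    tassoc y z x \o tbraid x (tens y z) \o tassoc x y z =
    tmap (idm y) (tbraid x z) \o tassoc y x z \o tmap (tbraid x y) (idm z);
  tbraid_sym : forall x y, tbraid y x \o tbraid x y = idm (tens x y)
}.

Arguments tunit : clear implicits.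
Notation "x ⊗ y" := (tens x y) (at level 35, right associativity)
  : cat_scope.

Definition braid_iso (V : smcat) (x y : V) : iso (x ⊗ y) (y ⊗ x) :=
  Iso (tbraid_sym x y) (tbraid_sym y x).

Lemma tmap_cancel (V : smcat) (x x' y y' : V) (f : x ~> x') (f' : x' ~> x)
  (g : y ~> y') (g' : y' ~> y) :
  f' \o f = idm x -> g' \o g = idm y -> tmap f' g' \o tmap f g = idm (x ⊗ y).
Proof. by move=> Hf Hg; rewrite -tmap_comp Hf Hg tmap_id. Qed.

Definition iso_tens (V : smcat) (x x' y y' : V) (i : iso x x')
  (j : iso y y') : iso (x ⊗ y) (x' ⊗ y') :=
  Iso (tmap_cancel (bwd_fwd i) (bwd_fwd j))
      (tmap_cancel (fwd_bwd i) (fwd_bwd j)).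

Record smfunctor (V W : smcat) := SMFunctor {
  smf_fun :> functor V W;
  fmu : forall x y, iso (smf_fun x ⊗ smf_fun y) (smf_fun (x ⊗ y));
  fmu0 : iso (tunit W) (smf_fun (tunit V));
  fmu_nat : forall x x' y y' (f : x ~> x') (g : y ~> y'),
    fmu x' y' \o tmap (fmap smf_fun f) (fmap smf_fun g) =
    fmap smf_fun (tmap f g) \o fmu x y;
  fmu_assoc : forall x y z,
    fmap smf_fun (tassoc x y z) \o fmu (x ⊗ y) z
      \o tmap (fmu x y) (idm (smf_fun z)) =
    fmu x (y ⊗ z) \o tmap (idm (smf_fun x)) (fmu y z)
      \o tassoc (smf_fun x) (smf_fun y) (smf_fun z);
  fmu_lunit : forall x,
    fmap smf_fun (tlunit x) \o fmu (tunit V) x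
      \o tmap fmu0 (idm (smf_fun x)) = tlunit (smf_fun x);
  fmu_runit : forall x,
    fmap smf_fun (trunit x) \o fmu x (tunit V)
      \o tmap (idm (smf_fun x)) fmu0 = trunit (smf_fun x);
  fmu_braid : forall x y,
    fmap smf_fun (tbraid x y) \o fmu x y =
    fmu y x \o tbraid (smf_fun x) (smf_fun y)
}.

Arguments fmu0 {V W} _.

Section SMFunctorId.
Variable V : smcat.

Let F := fun_id V.

Lemma smf_id_nat (x x' y y' : V) (f : x ~> x') (g : y ~> y') :
  iso_id (F x' ⊗ F y') \o tmap (fmap F f) (fmap F g) =
  fmap F (tmap f g) \o iso_id (F x ⊗ F y).
Proof. by rewrite /= comp_idl comp_idr. Qed.

Lemma smf_id_assoc (x y z : V) :
  fmap F (tassoc x y z) \o iso_id ((x ⊗ y) ⊗ z)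
    \o tmap (iso_id (x ⊗ y)) (idm (F z)) =
  iso_id (x ⊗ y ⊗ z) \o tmap (idm (F x)) (iso_id (y ⊗ z))
    \o tassoc (F x) (F y) (F z).
Proof. by rewrite /= !tmap_id !comp_idr !comp_idl. Qed.

Lemma smf_id_lunit (x : V) :
  fmap F (tlunit x) \o iso_id (tunit V ⊗ x)
    \o tmap (iso_id (tunit V)) (idm (F x)) = tlunit (F x).
Proof. by rewrite /= !tmap_id !comp_idr. Qed.

Lemma smf_id_runit (x : V) :
  fmap F (trunit x) \o iso_id (x ⊗ tunit V)
    \o tmap (idm (F x)) (iso_id (tunit V)) = trunit (F x).
Proof. by rewrite /= !tmap_id !comp_idr. Qed.

Lemma smf_id_braid (x y : V) :
  fmap F (tbraid x y) \o iso_id (x ⊗ y) =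
  iso_id (y ⊗ x) \o tbraid (F x) (F y).
Proof. by rewrite /= comp_idl comp_idr. Qed.

Definition smf_id : smfunctor V V :=
  @SMFunctor V V F (fun x y => iso_id (x ⊗ y)) (iso_id (tunit V))
    smf_id_nat smf_id_assoc smf_id_lunit smf_id_runit smf_id_braid.

End SMFunctorId.

Section SMFunctorComp.
Variables (V W X : smcat) (G : smfunctor W X) (F : smfunctor V W).

Let GF := fun_comp G F.

Definition smf_comp_mu (x y : V) : iso (GF x ⊗ GF y) (GF (x ⊗ y)) :=
  fmu G (F x) (F y) >>> iso_map G (fmu F x y).

Definition smf_comp_mu0 : iso (tunit X) (GF (tunit V)) :=
  fmu0 G >>> iso_map G (fmu0 F).

Lemma tmap_compl (x x' x'' y : X) (f : x' ~> x'') (g : x ~> x') :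
  tmap (f \o g) (idm y) = tmap f (idm y) \o tmap g (idm y).
Proof. by rewrite -tmap_comp comp_idl. Qed.

Lemma tmap_compr (x x' x'' y : X) (f : x' ~> x'') (g : x ~> x') :
  tmap (idm y) (f \o g) = tmap (idm y) f \o tmap (idm y) g.
Proof. by rewrite -tmap_comp comp_idl. Qed.

Lemma smf_comp_nat (x x' y y' : V) (f : x ~> x') (g : y ~> y') :
  smf_comp_mu x' y' \o tmap (fmap GF f) (fmap GF g) =
  fmap GF (tmap f g) \o smf_comp_mu x y.
Proof.
by rewrite /= -compA fmu_nat compA -fmap_comp fmu_nat fmap_comp -!compA.
Qed.

Lemma smf_comp_assoc (x y z : V) :
  fmap GF (tassoc x y z) \o smf_comp_mu (x ⊗ y) z
    \o tmap (smf_comp_mu x y) (idm (GF z)) =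
  smf_comp_mu x (y ⊗ z) \o tmap (idm (GF x)) (smf_comp_mu y z)
    \o tassoc (GF x) (GF y) (GF z).
Proof.
rewrite /= tmap_compl tmap_compr.
have E1 := fmu_nat G (fmu F x y) (idm (F z)).
have E2 := fmu_nat G (idm (F x)) (fmu F y z).
rewrite fmap_id in E1; rewrite fmap_id in E2.
rewrite -!compA (compA (fmu G _ _) (tmap (fmap G (fmu F x y)) _)) E1.
rewrite (compA (fmu G _ _) (tmap _ (fmap G (fmu F y z)))) E2.
rewrite -!compA (compA (fmu G _ _) (tmap _ (fmu G _ _))) -fmu_assoc.
by rewrite !compA -!fmap_comp fmu_assoc.
Qed.

Lemma smf_comp_lunit (x : V) :
  fmap GF (tlunit x) \o smf_comp_mu (tunit V) x
    \o tmap smf_comp_mu0 (idm (GF x)) = tlunit (GF x).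
Proof.
rewrite /= tmap_compl.
have E := fmu_nat G (fmu0 F) (idm (F x)); rewrite fmap_id in E.
rewrite -!compA (compA (fmu G _ _) (tmap (fmap G (fmu0 F)) _)) E.
by rewrite !compA -!fmap_comp fmu_lunit fmu_lunit.
Qed.

Lemma smf_comp_runit (x : V) :
  fmap GF (trunit x) \o smf_comp_mu x (tunit V)
    \o tmap (idm (GF x)) smf_comp_mu0 = trunit (GF x).
Proof.
rewrite /= tmap_compr.
have E := fmu_nat G (idm (F x)) (fmu0 F); rewrite fmap_id in E.
rewrite -!compA (compA (fmu G _ _) (tmap _ (fmap G (fmu0 F)))) E.
by rewrite !compA -!fmap_comp fmu_runit fmu_runit.
Qed.

Lemma smf_comp_braid (x y : V) :
  fmap GF (tbraid x y) \o smf_comp_mu x y =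
  smf_comp_mu y x \o tbraid (GF x) (GF y).
Proof.
by rewrite /= compA -fmap_comp fmu_braid fmap_comp -!compA fmu_braid.
Qed.

Definition smf_comp : smfunctor V X :=
  @SMFunctor V X GF smf_comp_mu smf_comp_mu0 smf_comp_nat smf_comp_assoc
    smf_comp_lunit smf_comp_runit smf_comp_braid.

End SMFunctorComp.

(* an invertible monoidal natural transformation *)
Record moniso (V W : smcat) (F G : smfunctor V W) := MonIso {
  mniso :> forall x, iso (F x) (G x);
  mniso_nat : forall x y (f : x ~> y),
    mniso y \o fmap F f = fmap G f \o mniso x;
  mniso_tens : forall x y,
    mniso (x ⊗ y) \o fmu F x y = fmu G x y \o tmap (mniso x) (mniso y);
  mniso_unit : mniso (tunit V) \o fmu0 F = fmu0 G
}.

Section SMDuality.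
Variable V : smcat.

Definition is_dual (M N : V) : Prop :=
  exists (eta : tunit V ~> M ⊗ N) (eps : N ⊗ M ~> tunit V),
    (trunit M \o tmap (idm M) eps \o tassoc M N M \o tmap eta (idm M)
       \o bwd (tlunit M) = idm M) /\
    (tlunit N \o tmap eps (idm N) \o bwd (tassoc N M N) \o tmap (idm N) eta
       \o bwd (trunit N) = idm N).

Definition dualizable (M : V) : Prop := exists N, is_dual M N.

End SMDuality.

(* Only the structure of a bicategory is recorded, since the definition of
   right duals uses nothing else.  [hcomp M N] is the composite of
   [M : R -> S] and [N : S -> T], in diagrammatic order. *)
Record bicat_data := BicatData {
  cell0 :> Type;
  cell1 : cell0 -> cell0 -> category;
  unit1 : forall R, cell1 R R;
  hcomp : forall R S T, cell1 R S -> cell1 S T -> cell1 R T;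
  hcomp2 : forall R S T (M M' : cell1 R S) (N N' : cell1 S T),
    (M ~> M') -> (N ~> N') -> (hcomp M N ~> hcomp M' N');
  bassoc : forall R S T Z (M : cell1 R S) (N : cell1 S T) (P : cell1 T Z),
    iso (hcomp (hcomp M N) P) (hcomp M (hcomp N P));
  blunit : forall R S (M : cell1 R S), iso (hcomp (unit1 R) M) M;
  brunit : forall R S (M : cell1 R S), iso (hcomp M (unit1 S)) M
}.

Section RightDuality.
Variables (B : bicat_data) (R S : B).

Definition is_right_dual (M : cell1 R S) (N : cell1 S R) : Prop :=
  exists (eta : unit1 R ~> hcomp M N) (eps : hcomp N M ~> unit1 S),
    (brunit M \o hcomp2 (idm M) eps \o bassoc M N M \o hcomp2 eta (idm M)
       \o bwd (blunit M) = idm M) /\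
    (blunit N \o hcomp2 eps (idm N) \o bwd (bassoc N M N)
       \o hcomp2 (idm N) eta \o bwd (brunit N) = idm N).

Definition right_dualizable (M : cell1 R S) : Prop :=
  exists N, is_right_dual M N.

End RightDuality.

Record fpcat := FPCat {
  fp_cat :> category;
  one : fp_cat;
  bang : forall A : fp_cat, A ~> one;
  bang_uniq : forall (A : fp_cat) (f g : A ~> one), f = g;
  prod : fp_cat -> fp_cat -> fp_cat;
  p1 : forall A B, prod A B ~> A;
  p2 : forall A B, prod A B ~> B;
  pair : forall X A B : fp_cat, (X ~> A) -> (X ~> B) -> (X ~> prod A B);
  p1_pair : forall (X A B : fp_cat) (f : X ~> A) (g : X ~> B),
    p1 A B \o pair f g = f;
  p2_pair : forall (X A B : fp_cat) (f : X ~> A) (g : X ~> B),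
    p2 A B \o pair f g = g;
  pair_ext : forall (X A B : fp_cat) (f g : X ~> prod A B),
    p1 A B \o f = p1 A B \o g -> p2 A B \o f = p2 A B \o g -> f = g
}.

Arguments one : clear implicits.
Arguments p1 {_ A B}.
Arguments p2 {_ A B}.
Notation "A ** B" := (prod A B) (at level 36, right associativity) : cat_scope.
Notation "<< f , g >>" := (pair f g) (at level 0, f at level 99,
  g at level 99, format "<< f ,  g >>") : cat_scope.

Definition pmap (S : fpcat) (A A' B B' : S) (f : A ~> A') (g : B ~> B') :
  A ** B ~> A' ** B' := << f \o p1, g \o p2 >>.

Notation "f *** g" := (pmap f g) (at level 36, right associativity)
  : cat_scope.

Definition diag (S : fpcat) (A : S) : A ~> A ** A := << idm A, idm A >>.

Lemma pair_comp (S : fpcat) (X Y A B : S) (f : Y ~> A) (g : Y ~> B)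
  (h : X ~> Y) : << f, g >> \o h = << f \o h, g \o h >>.
Proof. by apply: pair_ext; rewrite compA !(p1_pair, p2_pair). Qed.

Lemma p1_pairA (S : fpcat) (W X A B : S) (f : X ~> A) (g : X ~> B)
  (h : W ~> X) : p1 \o (<< f, g >> \o h) = f \o h.
Proof. by rewrite compA p1_pair. Qed.

Lemma p2_pairA (S : fpcat) (W X A B : S) (f : X ~> A) (g : X ~> B)
  (h : W ~> X) : p2 \o (<< f, g >> \o h) = g \o h.
Proof. by rewrite compA p2_pair. Qed.

Ltac prod_simpl :=
  rewrite /diag /pmap /=;
  rewrite -?compA;
  rewrite ?(pair_comp, p1_pair, p2_pair, p1_pairA, p2_pairA,
            comp_idl, comp_idr);
  rewrite -?compA.

Ltac prod_eq :=
  repeat progress prod_simpl;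
  try reflexivity;
  try (apply: bang_uniq);
  try (apply: pair_ext; prod_eq).

(*      nw --top--> ne
        |           |
       left       right
        v           v
        sw --bot--> se      *)
Record square (S : category) := Square {
  nw : S; ne : S; sw : S; se : S;
  top : nw ~> ne;
  left : nw ~> sw;
  right : ne ~> se;
  bot : sw ~> se;
  sq_comm : right \o top = bot \o left
}.

Definition sq_transpose (S : category) (s : square S) : square S :=
  Square (eq_sym (sq_comm s)).

Record square_iso (S : category) (s s' : square S) := SquareIso {
  iso_nw : iso (nw s) (nw s');
  iso_ne : iso (ne s) (ne s');
  iso_sw : iso (sw s) (sw s');
  iso_se : iso (se s) (se s');
  iso_top : top s' \o iso_nw = iso_ne \o top s;
  iso_left : left s' \o iso_nw = iso_sw \o left s;
  iso_right : right s' \o iso_ne = iso_se \o right s;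
  iso_bot : bot s' \o iso_sw = iso_se \o bot s
}.

Section RequiredSquares.
Variable S : fpcat.

Lemma sq_a_comm (A B C D : S) (f : A ~> B) (g : C ~> D) :
  (idm B *** g) \o (f *** idm C) = (f *** idm D) \o (idm A *** g).
Proof. by prod_eq. Qed.

Definition sq_a (A B C D : S) (f : A ~> B) (g : C ~> D) : square S :=
  Square (sq_a_comm f g).

Definition prodA (A B C : S) : (A ** B) ** C ~> A ** (B ** C) :=
  << p1 \o p1, << p2 \o p1, p2 >> >>.

Lemma sq_b_comm (A : S) :
  (idm A *** diag A) \o diag A = (prodA A A A \o (diag A *** idm A)) \o diag A.
Proof. by rewrite /prodA; prod_eq. Qed.

Definition sq_b (A : S) : square S := Square (sq_b_comm A).

Lemma sq_c_comm (A B : S) (f : A ~> B) :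
  (f *** idm B) \o << idm A, f >> = diag B \o f.
Proof. by prod_eq. Qed.

Definition sq_c (A B : S) (f : A ~> B) : square S := Square (sq_c_comm f).

Lemma sq_prod_comm (X : S) (s : square S) :
  (idm X *** right s) \o (idm X *** top s) =
  (idm X *** bot s) \o (idm X *** left s).
Proof.
by rewrite /pmap !pair_comp -!compA !p1_pair !p2_pair !comp_idl !compA sq_comm.
Qed.

Definition sq_prod (X : S) (s : square S) : square S :=
  Square (sq_prod_comm X s).

(* Closure under isomorphism of squares makes precise the suppression of
   canonical isomorphisms such as [A ** one ~ A], of rebracketings, and of the
   side on which the product with a fixed object is taken.  It is not an extra
   restriction: whether the Beck-Chevalley morphism of a square is invertible
   depends only on the isomorphism class of the square. *)
Inductive required_square : square S -> Prop :=
| req_a A B C D (f : A ~> B) (g : C ~> D) : required_square (sq_a f g)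
| req_b A : required_square (sq_b A)
| req_c A B (f : A ~> B) : required_square (sq_c f)
| req_transpose s : required_square s -> required_square (sq_transpose s)
| req_prod X s : required_square s -> required_square (sq_prod X s)
| req_iso s s' : square_iso s s' -> required_square s -> required_square s'.

End RequiredSquares.

(* A pseudofunctor from [S^op] to symmetric monoidal categories.  Since 2-cells
   of [S] are equalities, the coherence laws compare [re] at provably equal
   arrows through [iso_eq]. *)
Record indexed_smcat (S : category) := IndexedSMCat {
  fib :> S -> smcat;
  re : forall A B : S, (A ~> B) -> smfunctor (fib B) (fib A);
  re_id : forall A, moniso (re (idm A)) (smf_id (fib A));
  re_comp : forall (A B C : S) (f : A ~> B) (g : B ~> C),
    moniso (smf_comp (re f) (re g)) (re (g \o f));
  re_assoc : forall (A B C D : S) (f : A ~> B) (g : B ~> C) (h : C ~> D)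
    (M : fib D),
    re_comp f (h \o g) M \o fmap (re f) (re_comp g h M) =
    iso_eq (fun k => re k M) (compA h g f)
      \o (re_comp (g \o f) h M \o re_comp f g (re h M));
  re_idl : forall (A B : S) (f : A ~> B) (M : fib B),
    iso_eq (fun k => re k M) (comp_idl f) \o re_comp f (idm B) M =
    fmap (re f) (re_id B M);
  re_idr : forall (A B : S) (f : A ~> B) (M : fib B),
    iso_eq (fun k => re k M) (comp_idr f) \o re_comp (idm A) f M =
    re_id A (re f M)
}.

Section Reindexing.
Variables (S : category) (C : indexed_smcat S).

Local Notation "f ^*" := (re C f) (at level 2, format "f ^*").

Definition re_eq (A B : S) (f g : A ~> B) (e : f = g) (M : C B) :
  iso (f^* M) (g^* M) := iso_eq (fun h => h^* M) e.

Definition re1 (A : S) (M : C A) : iso ((idm A)^* M) M := re_id C A M.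

Definition re2 (A B D : S) (f : A ~> B) (g : B ~> D) (M : C D) :
  iso (f^* (g^* M)) ((g \o f)^* M) := re_comp C f g M.

Definition re_sq (A B B' D : S) (f : A ~> B) (g : B ~> D) (f' : A ~> B')
  (g' : B' ~> D) (e : g \o f = g' \o f') (M : C D) :
  iso (f^* (g^* M)) (f'^* (g'^* M)) :=
  re2 f g M >>> re_eq e M >>> iso_inv (re2 f' g' M).

End Reindexing.

Record pushforwards (S : category) (C : indexed_smcat S) := Pushforwards {
  push : forall A B : S, (A ~> B) -> functor (C A) (C B);
  push_adj : forall (A B : S) (f : A ~> B), adjunction (push f) (re C f)
}.

Section Canonical.
Variables (S : category) (C : indexed_smcat S) (K : pushforwards C).

Local Notation "f ^*" := (re C f) (at level 2, format "f ^*").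
Local Notation "f `!" := (push K f) (at level 2, format "f `!").

Definition bc_map (s : square S) (M : C (sw s)) :
  (top s)`! ((left s)^* M) ~> (right s)^* ((bot s)`! M) :=
  acounit (push_adj K (top s)) ((right s)^* ((bot s)`! M))
    \o fmap (top s)`! (re_sq (eq_sym (sq_comm s)) ((bot s)`! M))
    \o fmap (top s)`! (fmap (left s)^* (aunit (push_adj K (bot s)) M)).

Definition proj_map (A B : S) (f : A ~> B) (M : C B) (N : C A) :
  f`! (f^* M ⊗ N) ~> M ⊗ f`! N :=
  acounit (push_adj K f) (M ⊗ f`! N)
    \o fmap f`! (fmu f^* M (f`! N))
    \o fmap f`! (tmap (idm (f^* M)) (aunit (push_adj K f) N)).

End Canonical.

Record indexed_coproducts (S : fpcat) (C : indexed_smcat S) :=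
  IndexedCoproducts {
  pushf :> pushforwards C;
  hopb : square S -> Prop;
  hopb_required : forall s, required_square s -> hopb s;
  bc_iso : forall s, hopb s -> forall M : C (sw s), is_iso (bc_map pushf M);
  proj_iso : forall (A B : S) (f : A ~> B) (M : C B) (N : C A),
    is_iso (proj_map pushf f M N)
}.

Section Transpose.
Variables (C D : category) (L : functor C D) (R : functor D C)
  (a : adjunction L R).

Lemma adj_beta (x : C) (y : D) (h : x ~> R y) :
  fmap R (acounit a y \o fmap L h) \o aunit a x = h.
Proof.
by rewrite fmap_comp -compA -aunit_nat compA adj_triR comp_idl.
Qed.

Lemma adj_ext (x : C) (y : D) (g g' : L x ~> y) :
  fmap R g \o aunit a x = fmap R g' \o aunit a x -> g = g'.
Proof.
have E k : k = acounit a y \o fmap L (fmap R k \o aunit a x).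
  by rewrite fmap_comp compA -acounit_nat -compA adj_triL comp_idr.
by move=> H; rewrite (E g) (E g') H.
Qed.

End Transpose.

Section AdjComp.
Variables (C D E : category) (L : functor C D) (R : functor D C)
  (L' : functor D E) (R' : functor E D)
  (a : adjunction L R) (a' : adjunction L' R').

Definition adjc_unit (x : C) : x ~> R (R' (L' (L x))) :=
  fmap R (aunit a' (L x)) \o aunit a x.

Definition adjc_counit (y : E) : L' (L (R (R' y))) ~> y :=
  acounit a' y \o fmap L' (acounit a (R' y)).

Lemma adjc_unit_nat (x x' : C) (f : x ~> x') :
  adjc_unit x' \o f =
  fmap (fun_comp R R') (fmap (fun_comp L' L) f) \o adjc_unit x.
Proof.
by rewrite /adjc_unit /= -compA aunit_nat !compA -!fmap_comp aunit_nat.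
Qed.

Lemma adjc_counit_nat (y y' : E) (g : y ~> y') :
  g \o adjc_counit y =
  adjc_counit y' \o fmap (fun_comp L' L) (fmap (fun_comp R R') g).
Proof.
by rewrite /adjc_counit /= compA acounit_nat -!compA -!fmap_comp acounit_nat.
Qed.

Lemma adjc_triL (x : C) :
  adjc_counit (L' (L x)) \o fmap (fun_comp L' L) (adjc_unit x) =
  idm (L' (L x)).
Proof.
rewrite /adjc_counit /adjc_unit /= -compA -fmap_comp.
rewrite [fmap L (_ \o _)]fmap_comp compA -acounit_nat -compA adj_triL comp_idr.
exact: adj_triL.
Qed.

Lemma adjc_triR (y : E) :
  fmap (fun_comp R R') (adjc_counit y) \o adjc_unit (R (R' y)) =
  idm (R (R' y)).
Proof.
rewrite /adjc_counit /adjc_unit /= compA -fmap_comp.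
rewrite [fmap R' (_ \o _)]fmap_comp -compA -aunit_nat compA adj_triR comp_idl.
exact: adj_triR.
Qed.

Definition adj_comp : adjunction (fun_comp L' L) (fun_comp R R') :=
  @Adjunction C E (fun_comp L' L) (fun_comp R R') adjc_unit adjc_counit
    adjc_unit_nat adjc_counit_nat adjc_triL adjc_triR.

End AdjComp.

Lemma adj_id_nat (C : category) (x x' : C) (f : x ~> x') :
  idm x' \o f = f \o idm x.
Proof. by rewrite comp_idl comp_idr. Qed.

Definition adj_id (C : category) : adjunction (fun_id C) (fun_id C) :=
  @Adjunction C C (fun_id C) (fun_id C) (@idm C) (@idm C)
    (@adj_id_nat C) (fun y y' g => eq_sym (adj_id_nat g))
    (fun x => comp_idl (idm x)) (fun x => comp_idl (idm x)).

Section LeftAdjointUnique.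
Variables (C D : category) (L1 L2 : functor C D) (R1 R2 : functor D C)
  (a1 : adjunction L1 R1) (a2 : adjunction L2 R2)
  (r : forall y, iso (R1 y) (R2 y))
  (r_nat : forall y y' (g : y ~> y'), r y' \o fmap R1 g = fmap R2 g \o r y).

Definition lau_fwd (x : C) : L1 x ~> L2 x :=
  acounit a1 (L2 x) \o fmap L1 (bwd (r (L2 x)) \o aunit a2 x).

Definition lau_bwd (x : C) : L2 x ~> L1 x :=
  acounit a2 (L1 x) \o fmap L2 (r (L1 x) \o aunit a1 x).

Lemma r_nat_inv y y' (g : y ~> y') :
  fmap R1 g \o bwd (r y) = bwd (r y') \o fmap R2 g.
Proof.
rewrite -[LHS]comp_idl -(bwd_fwd (r y')) -compA (compA (r y')) r_nat.
by rewrite -compA fwd_bwd comp_idr.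
Qed.

Lemma lau_bwd_fwd (x : C) : lau_bwd x \o lau_fwd x = idm (L1 x).
Proof.
apply: (adj_ext (a := a1)).
rewrite fmap_comp -compA adj_beta compA r_nat_inv -compA adj_beta.
by rewrite compA bwd_fwd fmap_id.
Qed.

Lemma lau_fwd_bwd (x : C) : lau_fwd x \o lau_bwd x = idm (L2 x).
Proof.
apply: (adj_ext (a := a2)).
rewrite fmap_comp -compA adj_beta compA -r_nat -compA adj_beta.
by rewrite compA fwd_bwd fmap_id.
Qed.

Definition left_adjoint_unique (x : C) : iso (L1 x) (L2 x) :=
  Iso (lau_bwd_fwd x) (lau_fwd_bwd x).

End LeftAdjointUnique.

Section Bicategory.
Variables (S : fpcat) (C : indexed_smcat S) (K : indexed_coproducts C).

Local Notation "f ^*" := (re C f) (at level 2, format "f ^*").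
Local Notation "f `!" := (push K f) (at level 2, format "f `!").

Definition push_id (A : S) (M : C A) : iso ((idm A)`! M) M :=
  left_adjoint_unique (push_adj K (idm A)) (adj_id (C A))
    (@mniso_nat _ _ _ _ (re_id C A)) M.

Definition push_comp (A B D : S) (f : A ~> B) (g : B ~> D) (M : C A) :
  iso (g`! (f`! M)) ((g \o f)`! M) :=
  left_adjoint_unique (adj_comp (push_adj K f) (push_adj K g))
    (push_adj K (g \o f)) (@mniso_nat _ _ _ _ (re_comp C f g)) M.

Definition push_eq (A B : S) (f g : A ~> B) (e : f = g) (M : C A) :
  iso (f`! M) (g`! M) := iso_eq (fun h => h`! M) e.

Definition bc (s : square S) (r : required_square s) (M : C (sw s)) :
  iso ((top s)`! ((left s)^* M)) ((right s)^* ((bot s)`! M)) :=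
  iso_of (bc_iso (hopb_required K r) M).

Definition proj (A B : S) (f : A ~> B) (M : C B) (N : C A) :
  iso (f`! (f^* M ⊗ N)) (M ⊗ f`! N) := iso_of (proj_iso K f M N).

Definition box (A B : S) (M : C A) (N : C B) : C (A ** B) :=
  p1^* M ⊗ p2^* N.

Definition box_map (A B : S) (M M' : C A) (N N' : C B) (u : M ~> M')
  (v : N ~> N') : box M N ~> box M' N' :=
  tmap (fmap p1^* u) (fmap p2^* v).

Definition box_iso (A B : S) (M M' : C A) (N N' : C B) (u : iso M M')
  (v : iso N N') : iso (box M N) (box M' N') :=
  iso_tens (iso_map p1^* u) (iso_map p2^* v).

Lemma p1_pmap (A A' B B' : S) (f : A ~> A') (g : B ~> B') :
  p1 \o (f *** g) = f \o p1.
Proof. by prod_eq. Qed.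

Lemma p2_pmap (A A' B B' : S) (f : A ~> A') (g : B ~> B') :
  p2 \o (f *** g) = g \o p2.
Proof. by prod_eq. Qed.

Definition box_re (A A' B B' : S) (f : A ~> A') (g : B ~> B') (M : C A')
  (N : C B') : iso (box (f^* M) (g^* N)) ((f *** g)^* (box M N)) :=
  iso_tens (re_sq (eq_sym (p1_pmap f g)) M) (re_sq (eq_sym (p2_pmap f g)) N)
  >>> fmu (f *** g)^* (p1^* M) (p2^* N).

Definition box_re_l (A A' B : S) (f : A ~> A') (M : C A') (N : C B) :
  iso (box (f^* M) N) ((f *** idm B)^* (box M N)) :=
  box_iso (iso_id (f^* M)) (iso_inv (re1 N)) >>> box_re f (idm B) M N.

Definition box_re_r (A B B' : S) (g : B ~> B') (M : C A) (N : C B') :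
  iso (box M (g^* N)) ((idm A *** g)^* (box M N)) :=
  box_iso (iso_inv (re1 M)) (iso_id (g^* N)) >>> box_re (idm A) g M N.

Lemma box_assoc_eq1 (A B D : S) :
  p1 \o prodA A B D = p1 \o p1.
Proof. by rewrite /prodA; prod_eq. Qed.

Lemma box_assoc_eq2 (A B D : S) :
  p2 \o p1 = p1 \o (p2 \o prodA A B D).
Proof. by rewrite /prodA; prod_eq. Qed.

Lemma box_assoc_eq3 (A B D : S) :
  p2 \o (p2 \o prodA A B D) = p2.
Proof. by rewrite /prodA; prod_eq. Qed.

Definition box_assoc (A B D : S) (M : C A) (N : C B) (P : C D) :
  iso (box (box M N) P) ((prodA A B D)^* (box M (box N P))) :=
  iso_tens (iso_inv (fmu p1^* (p1^* M) (p2^* N))) (iso_id (p2^* P))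
  >>> tassoc (p1^* (p1^* M)) (p1^* (p2^* N)) (p2^* P)
  >>> iso_tens
        (re_sq (eq_sym (box_assoc_eq1 A B D)) M)
        (iso_tens
           (re_sq (box_assoc_eq2 A B D) N)
           (iso_inv (re_eq (box_assoc_eq3 A B D) P)
            >>> iso_inv (re2 (p2 \o prodA A B D) p2 P))
         >>> fmu (p2 \o prodA A B D)^* (p1^* N) (p2^* P)
         >>> iso_inv (re2 (prodA A B D) p2 (box N P)))
  >>> fmu (prodA A B D)^* (p1^* M) (p2^* (box N P)).

(* Compatibility of the external product with pushforward in one variable:
   Beck-Chevalley along a projection, then the projection formula. *)
Lemma sq_pl_comm (A B D : S) (f : A ~> B) :
  p1 \o (f *** idm D) = f \o p1.
Proof. exact: p1_pmap. Qed.

Definition sq_pl (A B D : S) (f : A ~> B) : square S :=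
  Square (sq_pl_comm D f).

Lemma sq_pr_comm (A B D : S) (f : A ~> B) :
  p2 \o (idm D *** f) = f \o p2.
Proof. exact: p2_pmap. Qed.

Definition sq_pr (A B D : S) (f : A ~> B) : square S :=
  Square (sq_pr_comm D f).

Lemma prod_one_l (A : S) : << idm A, bang A >> \o p1 = idm (A ** one S).
Proof. by prod_eq. Qed.

Lemma prod_one_r (A : S) : << bang A, idm A >> \o p2 = idm (one S ** A).
Proof. by prod_eq. Qed.

Definition prod_one (A : S) : iso (A ** one S) A :=
  Iso (prod_one_l A) (p1_pair (idm A) (bang A)).

Definition one_prod (A : S) : iso (one S ** A) A :=
  Iso (prod_one_r A) (p2_pair (bang A) (idm A)).

Lemma sq_pl_required (A B D : S) (f : A ~> B) : required_square (sq_pl D f).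
Proof.
apply: (@req_iso S (sq_a f (bang D))); last exact: req_a.
by exists (iso_id (A ** D)) (iso_id (B ** D)) (prod_one A) (prod_one B);
  rewrite /=; prod_eq.
Qed.

Lemma sq_pr_required (A B D : S) (f : A ~> B) : required_square (sq_pr D f).
Proof.
apply: (@req_iso S (sq_transpose (sq_a (bang D) f)));
  last by apply: req_transpose; exact: req_a.
by exists (iso_id (D ** A)) (iso_id (D ** B)) (one_prod A) (one_prod B);
  rewrite /=; prod_eq.
Qed.

Lemma p2_pmap_id (A B D : S) (f : A ~> B) : p2 \o (f *** idm D) = p2.
Proof. by prod_eq. Qed.

Lemma p1_pmap_id (A B D : S) (f : A ~> B) : p1 \o (idm D *** f) = p1.
Proof. by prod_eq. Qed.

Definition box_push_l (A B D : S) (f : A ~> B) (M : C A) (P : C D) :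
  iso ((f *** idm D)`! (box M P)) (box (f`! M) P) :=
  iso_map (f *** idm D)`! (braid_iso (p1^* M) (p2^* P))
  >>> iso_map (f *** idm D)`!
        (iso_tens
           (iso_inv (re2 (f *** idm D) p2 P >>> re_eq (p2_pmap_id D f) P))
           (iso_id (p1^* M)))
  >>> proj (f *** idm D) (p2^* P) (p1^* M)
  >>> braid_iso (p2^* P) ((f *** idm D)`! (p1^* M))
  >>> iso_tens (bc (sq_pl_required D f) M) (iso_id (p2^* P)).

Definition box_push_r (A B D : S) (f : A ~> B) (P : C D) (M : C A) :
  iso ((idm D *** f)`! (box P M)) (box P (f`! M)) :=
  iso_map (idm D *** f)`!
    (iso_tens
       (iso_inv (re2 (idm D *** f) p1 P >>> re_eq (p1_pmap_id D f) P))
       (iso_id (p2^* M)))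
  >>> proj (idm D *** f) (p1^* P) (p2^* M)
  >>> iso_tens (iso_id (p1^* P)) (bc (sq_pr_required D f) M).

(* [id_A x pi_B x id_D] *)
Definition mid_out (A B D : S) : A ** (B ** D) ~> A ** D :=
  << p1, p2 \o p2 >>.

(* [id_A x Delta_B x id_D] *)
Definition mid_diag (A B D : S) : A ** (B ** D) ~> (A ** B) ** (B ** D) :=
  << << p1, p1 \o p2 >>, p2 >>.

Definition odot (A B D : S) (M : C (A ** B)) (N : C (B ** D)) : C (A ** D) :=
  (mid_out A B D)`! ((mid_diag A B D)^* (box M N)).

Definition odot_map (A B D : S) (M M' : C (A ** B)) (N N' : C (B ** D))
  (u : M ~> M') (v : N ~> N') : odot M N ~> odot M' N' :=
  fmap (mid_out A B D)`! (fmap (mid_diag A B D)^* (box_map u v)).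

Definition U0 : C (one S) := tunit (C (one S)).

Definition odot_unit (A : S) : C (A ** A) := (diag A)`! ((bang A)^* U0).

(* [id_A x pi_B x pi_D x id_E] *)
Definition mid_out2 (A B D E : S) : A ** (B ** (D ** E)) ~> A ** E :=
  << p1, p2 \o (p2 \o p2) >>.

(* [id_A x Delta_B x Delta_D x id_E] *)
Definition mid_diag2 (A B D E : S) :
  A ** (B ** (D ** E)) ~> (A ** B) ** ((B ** D) ** (D ** E)) :=
  << << p1, p1 \o p2 >>, << << p1 \o p2, p1 \o (p2 \o p2) >>, p2 \o p2 >> >>.

Definition odot3 (A B D E : S) (M : C (A ** B)) (N : C (B ** D))
  (P : C (D ** E)) : C (A ** E) :=
  (mid_out2 A B D E)`! ((mid_diag2 A B D E)^* (box M (box N P))).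

Ltac prod_iso f g := refine (@Iso _ _ _ f g _ _); abstract prod_eq.

Definition prodA_iso (A B D : S) : iso ((A ** B) ** D) (A ** (B ** D)).
Proof.
prod_iso (prodA A B D)
  (<< << p1, p1 \o p2 >>, p2 \o p2 >> : A ** (B ** D) ~> (A ** B) ** D).
Defined.

Definition prod4_iso (A B D E : S) :
  iso ((A ** B) ** (D ** E)) ((A ** (B ** D)) ** E).
Proof.
prod_iso
  (<< << p1 \o p1, << p2 \o p1, p1 \o p2 >> >>, p2 \o p2 >>
     : (A ** B) ** (D ** E) ~> (A ** (B ** D)) ** E)
  (<< << p1 \o p1, p1 \o (p2 \o p1) >>, << p2 \o (p2 \o p1), p2 >> >>
     : (A ** (B ** D)) ** E ~> (A ** B) ** (D ** E)).
Defined.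

Definition swap_iso (A B : S) : iso (A ** B) (B ** A).
Proof.
prod_iso (<< p2, p1 >> : A ** B ~> B ** A) (<< p2, p1 >> : B ** A ~> A ** B).
Defined.

Section Left.
Variables (A B D E : S).

(* [id_A x pi_B x id_D x id_E] *)
Definition outL : A ** (B ** (D ** E)) ~> A ** (D ** E) := << p1, p2 \o p2 >>.

(* [id_A x id_B x Delta_D x id_E] *)
Definition diagL : A ** (B ** (D ** E)) ~> (A ** (B ** D)) ** (D ** E) :=
  << << p1, << p1 \o p2, p1 \o (p2 \o p2) >> >>, p2 \o p2 >>.

Lemma sq_L_comm :
  mid_diag A D E \o outL = (mid_out A B D *** idm (D ** E)) \o diagL.
Proof. by rewrite /mid_diag /outL /mid_out /diagL; prod_eq. Qed.

Definition sq_L : square S := Square sq_L_comm.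

Lemma sq_L_required : required_square sq_L.
Proof.
pose g : D ** E ~> D ** (D ** E) := << p1, idm (D ** E) >>.
apply: (@req_iso S (sq_a (@p1 S A B) g)); last exact: req_a.
by refine (@SquareIso S (sq_a (@p1 S A B) g) sq_L
    (prodA_iso A B (D ** E)) ( iso_id (A ** (D ** E)))
    ( prod4_iso A B D (D ** E))
    ( iso_inv (prodA_iso A D (D ** E))) _ _ _ _);
  rewrite /= /g /prodA /outL /diagL /mid_out /mid_diag; prod_eq.
Qed.

Lemma outL_eq : mid_out A D E \o outL = mid_out2 A B D E.
Proof. by rewrite /mid_out /outL /mid_out2; prod_eq. Qed.

Lemma diagL_eq :
  prodA (A ** B) (B ** D) (D ** E)
    \o ((mid_diag A B D *** idm (D ** E)) \o diagL) = mid_diag2 A B D E.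
Proof. by rewrite /prodA /mid_diag /diagL /mid_diag2; prod_eq. Qed.

Definition odot3_l (M : C (A ** B)) (N : C (B ** D)) (P : C (D ** E)) :
  iso (odot (odot M N) P) (odot3 M N P) :=
  iso_map (mid_out A D E)`!
    (iso_map (mid_diag A D E)^*
       (iso_inv (box_push_l (mid_out A B D) ((mid_diag A B D)^* (box M N)) P)
        >>> iso_map (mid_out A B D *** idm (D ** E))`!
              (box_re_l (mid_diag A B D) (box M N) P
               >>> iso_map (mid_diag A B D *** idm (D ** E))^*
                     (box_assoc M N P)))
     >>> iso_inv
           (bc sq_L_required
              ((mid_diag A B D *** idm (D ** E))^*
                 ((prodA (A ** B) (B ** D) (D ** E))^* (box M (box N P))))))
  >>> push_comp outL (mid_out A D E)
        (diagL^* ((mid_diag A B D *** idm (D ** E))^*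
           ((prodA (A ** B) (B ** D) (D ** E))^* (box M (box N P)))))
  >>> push_eq outL_eq
        (diagL^* ((mid_diag A B D *** idm (D ** E))^*
           ((prodA (A ** B) (B ** D) (D ** E))^* (box M (box N P)))))
  >>> iso_map (mid_out2 A B D E)`!
        (re2 diagL (mid_diag A B D *** idm (D ** E))
           ((prodA (A ** B) (B ** D) (D ** E))^* (box M (box N P)))
         >>> re2 ((mid_diag A B D *** idm (D ** E)) \o diagL)
               (prodA (A ** B) (B ** D) (D ** E)) (box M (box N P))
         >>> re_eq diagL_eq (box M (box N P))).

End Left.

Section Right.
Variables (A B D E : S).

(* [id_A x id_B x pi_D x id_E] *)
Definition outR : A ** (B ** (D ** E)) ~> A ** (B ** E) :=
  << p1, << p1 \o p2, p2 \o (p2 \o p2) >> >>.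

(* [id_A x Delta_B x id_D x id_E] *)
Definition diagR : A ** (B ** (D ** E)) ~> (A ** B) ** (B ** (D ** E)) :=
  << << p1, p1 \o p2 >>, p2 >>.

Lemma sq_R_comm :
  mid_diag A B E \o outR = (idm (A ** B) *** mid_out B D E) \o diagR.
Proof. by rewrite /mid_diag /outR /mid_out /diagR; prod_eq. Qed.

Definition sq_R : square S := Square sq_R_comm.

Lemma sq_R_required : required_square sq_R.
Proof.
pose g : A ** B ~> (A ** B) ** B := << idm (A ** B), p2 >>.
apply: (@req_iso S (sq_transpose (sq_a g (@p2 S D E))));
  last by apply: req_transpose; exact: req_a.
by refine (@SquareIso S (sq_transpose (sq_a g (@p2 S D E))) sq_R
    (prodA_iso A B (D ** E)) ( prodA_iso A B E)
    ( prodA_iso (A ** B) B (D ** E))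
    ( prodA_iso (A ** B) B E) _ _ _ _);
  rewrite /= /g /prodA /outR /diagR /mid_out /mid_diag; prod_eq.
Qed.

Lemma outR_eq : mid_out A B E \o outR = mid_out2 A B D E.
Proof. by rewrite /mid_out /outR /mid_out2; prod_eq. Qed.

Lemma diagR_eq :
  (idm (A ** B) *** mid_diag B D E) \o diagR = mid_diag2 A B D E.
Proof. by rewrite /mid_diag /diagR /mid_diag2; prod_eq. Qed.

Definition odot3_r (M : C (A ** B)) (N : C (B ** D)) (P : C (D ** E)) :
  iso (odot M (odot N P)) (odot3 M N P) :=
  iso_map (mid_out A B E)`!
    (iso_map (mid_diag A B E)^*
       (iso_inv (box_push_r (mid_out B D E) M ((mid_diag B D E)^* (box N P)))
        >>> iso_map (idm (A ** B) *** mid_out B D E)`!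
              (box_re_r (mid_diag B D E) M (box N P)))
     >>> iso_inv
           (bc sq_R_required
              ((idm (A ** B) *** mid_diag B D E)^* (box M (box N P)))))
  >>> push_comp outR (mid_out A B E)
        (diagR^* ((idm (A ** B) *** mid_diag B D E)^* (box M (box N P))))
  >>> push_eq outR_eq
        (diagR^* ((idm (A ** B) *** mid_diag B D E)^* (box M (box N P))))
  >>> iso_map (mid_out2 A B D E)`!
        (re2 diagR (idm (A ** B) *** mid_diag B D E) (box M (box N P))
         >>> re_eq diagR_eq (box M (box N P))).

End Right.

Definition odot_assoc (A B D E : S) (M : C (A ** B)) (N : C (B ** D))
  (P : C (D ** E)) : iso (odot (odot M N) P) (odot M (odot N P)) :=
  odot3_l M N P >>> iso_inv (odot3_r M N P).

Section RightUnitor.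
Variables (A B : S).

(* both are [id_A x Delta_B], up to rebracketing of the target *)
Definition diagU1 : A ** B ~> A ** (B ** B) := idm A *** diag B.
Definition diagU2 : A ** B ~> (A ** B) ** B := << idm (A ** B), p2 >>.

Lemma sq_ru_comm :
  mid_diag A B B \o diagU1 = (idm (A ** B) *** diag B) \o diagU2.
Proof. by rewrite /mid_diag /diagU1 /diagU2; prod_eq. Qed.

Definition sq_ru : square S := Square sq_ru_comm.

Lemma sq_ru_required : required_square sq_ru.
Proof.
apply: (@req_iso S (sq_prod A (sq_transpose (sq_b B)))); last first.
  by apply: req_prod; apply: req_transpose; exact: req_b.
by refine (@SquareIso S (sq_prod A (sq_transpose (sq_b B))) sq_ru
    (iso_id (A ** B)) ( iso_id (A ** (B ** B)))
    ( iso_inv (prodA_iso A B B))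
    ( iso_inv (prodA_iso A B (B ** B))) _ _ _ _);
  rewrite /= /prodA /diagU1 /diagU2 /mid_diag; prod_eq.
Qed.

Lemma out_diagU1 : mid_out A B B \o diagU1 = idm (A ** B).
Proof. by rewrite /mid_out /diagU1; prod_eq. Qed.

Lemma ru_eq1 : p1 \o ((idm (A ** B) *** bang B) \o diagU2) = idm (A ** B).
Proof. by rewrite /diagU2; prod_eq. Qed.

Lemma ru_eq2 :
  p2 \o ((idm (A ** B) *** bang B) \o diagU2) = bang (A ** B).
Proof. exact: bang_uniq. Qed.

Definition box_U_r (M : C (A ** B)) :
  iso (((idm (A ** B) *** bang B) \o diagU2)^* (box M U0)) M :=
  let k := (idm (A ** B) *** bang B) \o diagU2 in
  iso_inv (fmu k^* (p1^* M) (p2^* U0))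
  >>> iso_tens (re2 k p1 M >>> re_eq ru_eq1 M >>> re1 M)
        (re2 k p2 U0 >>> re_eq ru_eq2 U0
         >>> iso_inv (fmu0 (bang (A ** B))^* ))
  >>> trunit M.

Definition odot_runit (M : C (A ** B)) : iso (odot M (odot_unit B)) M :=
  iso_map (mid_out A B B)`!
    (iso_map (mid_diag A B B)^*
       (iso_inv (box_push_r (diag B) M ((bang B)^* U0))
        >>> iso_map (idm (A ** B) *** diag B)`! (box_re_r (bang B) M U0))
     >>> iso_inv
           (bc sq_ru_required ((idm (A ** B) *** bang B)^* (box M U0))))
  >>> push_comp diagU1 (mid_out A B B)
        (diagU2^* ((idm (A ** B) *** bang B)^* (box M U0)))
  >>> push_eq out_diagU1
        (diagU2^* ((idm (A ** B) *** bang B)^* (box M U0)))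
  >>> push_id (diagU2^* ((idm (A ** B) *** bang B)^* (box M U0)))
  >>> re2 diagU2 (idm (A ** B) *** bang B) (box M U0)
  >>> box_U_r M.

End RightUnitor.

Section LeftUnitor.
Variables (A B : S).

(* [Delta_A x id_B] *)
Definition diagU : A ** B ~> A ** (A ** B) := << p1, idm (A ** B) >>.

Lemma sq_lu_comm :
  mid_diag A A B \o diagU = (diag A *** idm (A ** B)) \o diagU.
Proof. by rewrite /mid_diag /diagU; prod_eq. Qed.

Definition sq_lu : square S := Square sq_lu_comm.

Lemma sq_lu_required : required_square sq_lu.
Proof.
apply: (@req_iso S (sq_prod B (sq_b A))); last by apply: req_prod; exact: req_b.
by refine (@SquareIso S (sq_prod B (sq_b A)) sq_lu
    (swap_iso B A) ( swap_iso B (A ** A) >>> prodA_iso A A B)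
    ( swap_iso B (A ** A) >>> prodA_iso A A B)
    ( swap_iso B (A ** (A ** A))
      >>> iso_inv (prod4_iso A A A B)) _ _ _ _);
  rewrite /= /prodA /diagU /mid_diag; prod_eq.
Qed.

Lemma out_diagU : mid_out A A B \o diagU = idm (A ** B).
Proof. by rewrite /mid_out /diagU; prod_eq. Qed.

Lemma lu_eq1 : p1 \o ((bang A *** idm (A ** B)) \o diagU) = bang (A ** B).
Proof. exact: bang_uniq. Qed.

Lemma lu_eq2 : p2 \o ((bang A *** idm (A ** B)) \o diagU) = idm (A ** B).
Proof. by rewrite /diagU; prod_eq. Qed.

Definition box_U_l (M : C (A ** B)) :
  iso (((bang A *** idm (A ** B)) \o diagU)^* (box U0 M)) M :=
  let k := (bang A *** idm (A ** B)) \o diagU in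
  iso_inv (fmu k^* (p1^* U0) (p2^* M))
  >>> iso_tens
        (re2 k p1 U0 >>> re_eq lu_eq1 U0
         >>> iso_inv (fmu0 (bang (A ** B))^* ))
        (re2 k p2 M >>> re_eq lu_eq2 M >>> re1 M)
  >>> tlunit M.

Definition odot_lunit (M : C (A ** B)) : iso (odot (odot_unit A) M) M :=
  iso_map (mid_out A A B)`!
    (iso_map (mid_diag A A B)^*
       (iso_inv (box_push_l (diag A) ((bang A)^* U0) M)
        >>> iso_map (diag A *** idm (A ** B))`! (box_re_l (bang A) U0 M))
     >>> iso_inv
           (bc sq_lu_required ((bang A *** idm (A ** B))^* (box U0 M))))
  >>> push_comp diagU (mid_out A A B)
        (diagU^* ((bang A *** idm (A ** B))^* (box U0 M)))
  >>> push_eq out_diagU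
        (diagU^* ((bang A *** idm (A ** B))^* (box U0 M)))
  >>> push_id (diagU^* ((bang A *** idm (A ** B))^* (box U0 M)))
  >>> re2 diagU (bang A *** idm (A ** B)) (box U0 M)
  >>> box_U_l M.

End LeftUnitor.

Definition bicat_over : bicat_data :=
  @BicatData S (fun A B => C (A ** B)) odot_unit odot odot_map
    odot_assoc odot_lunit odot_runit.

Definition hat (A : S) (M : C A) : cell1 (b := bicat_over) A (one S) :=
  (@p1 S A (one S))^* M.

Definition check (A : S) (M : C A) : cell1 (b := bicat_over) (one S) A :=
  (@p2 S (one S) A)^* M.

End Bicategory.

(* Main.v *)
From Corelib Require Import ssreflect.
From Stdlib Require Import Eqdep.
Require Import Defs.

Set Implicit Arguments.
Unset Strict Implicit.
Unset Printing Implicit Defensive.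
Local Open Scope cat_scope.

(** Right duality of [hat M] and duality of [M] both consist of a unit and a
    counit subject to two triangle identities, and the data determine each
    other.  Let [X : one -> A] be a 1-cell and [N] the object of the fibre over
    [A] that corresponds to it under [one ** A ~ A].  A 2-cell from the unit
    1-cell of [A] to the composite of [hat M] and [X] starts at a pushforward
    along the diagonal, and it ends at an external product, because the middle
    object is terminal.  By the universal properties of pushforward and
    reindexing it is a map from the unit object of the fibre over [A] to
    [M ⊗ N].  In the same way a 2-cell from the composite of [X] and [hat M]
    to the unit 1-cell of [one] is a map from [N ⊗ M] to the unit object.
    [eta_rel] and [eps_rel] express this correspondence.  [hat_triangle] and
    [check_triangle] show that each triangle composite of the bicategory is
    conjugate to the triangle composite of the fibre, so that one is an
    identity exactly when the other is, which gives [hat_dual_iff].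

    The triangle composites of the bicategory contain the associator and the
    unitors, which are pasted from Beck-Chevalley isomorphisms, projection
    formulas and coherence isomorphisms of the pseudofunctor.  To compute with
    them we pass to the total category (the Grothendieck construction): its
    objects are the objects of all fibres, and a map from [M] to [N] over [f]
    is a map from [M] to [f^* N].  Reindexing becomes a supply of cartesian maps
    and pushforward a supply of opcartesian ones, the external product becomes
    a bifunctor [box_hom], and every structural isomorphism is determined by
    one equation between maps of the total category: a Beck-Chevalley
    isomorphism makes a square of cartesian and opcartesian maps commute
    ([vert_bc]), and the associator carries one map out of the apex of a
    span to another ([odot_assoc_opcart]).  Coherence of the pseudofunctor
    makes the total category a category and tensor products of its maps
    functorial; from then on diagrams are checked by cancelling cartesian and
    opcartesian maps, with side conditions that are equations between maps of
    the base.

    Uniqueness of the right dual follows from the same correspondence: it turns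
    a right dual [X] of [hat M] into a dual of [M], and duals in a symmetric
    monoidal category are unique ([dual_unique]). *)

(** * Duals in a symmetric monoidal category *)

Lemma iso_epi (D : category) (x y z : D) (i : iso x y) (f g : y ~> z) :
  f \o i = g \o i -> f = g.
Proof.
by move=> E; rewrite -[f]comp_idr -[g]comp_idr -(fwd_bwd i) !compA E.
Qed.

Lemma iso_mono (D : category) (x y z : D) (i : iso y z) (f g : x ~> y) :
  i \o f = i \o g -> f = g.
Proof.
by move=> E; rewrite -[f]comp_idl -[g]comp_idl -(bwd_fwd i) -!compA E.
Qed.

Section Duals.
Variable V : smcat.
Implicit Types x y z : V.
Local Notation I := (tunit V).

(** Tensoring with the unit object is isomorphic to the identity functor. *)
Lemma tmap_unit_inj_l x y (f g : x ~> y) :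
  tmap (idm I) f = tmap (idm I) g -> f = g.
Proof.
by move=> E; apply: (iso_epi (i := tlunit x)); rewrite -!tlunit_nat E.
Qed.

Lemma tmap_unit_inj_r x y (f g : x ~> y) :
  tmap f (idm I) = tmap g (idm I) -> f = g.
Proof.
by move=> E; apply: (iso_epi (i := trunit x)); rewrite -!trunit_nat E.
Qed.

(** Kelly's consequence of the pentagon and triangle axioms: after tensoring
    with the unit object both sides are compared by one pentagon. *)
Lemma trunit_tens x y :
  trunit (x ⊗ y) = tmap (idm x) (trunit y) \o tassoc x y I :> (_ ~> _).
Proof.
apply: tmap_unit_inj_r; apply: (iso_mono (i := tassoc x y I)).
rewrite tmap_compl -tens_triangle !compA -[idm (x ⊗ y)]tmap_id tassoc_nat.
rewrite -compA tens_pentagon !compA -tmap_comp comp_idl tens_triangle.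
by rewrite tassoc_nat.
Qed.

Lemma tlunit_tens x y :
  tlunit (x ⊗ y) \o tassoc I x y = tmap (tlunit x) (idm y) :> (_ ~> _).
Proof.
apply: tmap_unit_inj_l.
apply: (iso_epi (i := tassoc I (I ⊗ x) y)).
apply: (iso_epi (i := iso_tens (tassoc I I x) (iso_id y))) => /=.
rewrite tmap_compr -!compA (compA _ (tassoc _ _ _) (tmap _ _)) -tens_pentagon.
rewrite compA tens_triangle -[idm (x ⊗ y)]tmap_id -tassoc_nat.
by rewrite compA -tassoc_nat -compA -tmap_compl tens_triangle.
Qed.

Lemma trunit_unit : trunit I = tlunit I :> (_ ~> _).
Proof.
apply: tmap_unit_inj_l; apply: (iso_epi (i := tassoc I I I)).
rewrite tens_triangle -trunit_tens; apply: (iso_mono (i := trunit I)).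
by rewrite trunit_nat.
Qed.

(** The comparison map between two duals transports one counit to the other.
    Sliding [eps] past the rest of the composite leaves [eps] after a triangle
    composite of the second duality, which is the identity. *)
Lemma counit_mate M N N' (eps : N ⊗ M ~> I) (eta' : I ~> M ⊗ N')
  (eps' : N' ⊗ M ~> I) :
  trunit M \o tmap (idm M) eps' \o tassoc M N' M \o tmap eta' (idm M)
    \o bwd (tlunit M) = idm M ->
  eps' \o tmap (tlunit N' \o tmap eps (idm N') \o bwd (tassoc N M N')
                 \o tmap (idm N) eta' \o bwd (trunit N)) (idm M) = eps.
Proof.
move=> T.
have E1 : eps' \o tmap (tlunit N' \o tmap eps (idm N')) (idm M) =
    eps \o (tmap (idm N) (trunit M)
            \o tmap (idm N) (tmap (idm M) eps'))
        \o (tassoc N M (N' ⊗ M) \o tassoc (N ⊗ M) N' M).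
  rewrite tmap_compl -tlunit_tens !compA -tlunit_nat -trunit_unit.
  rewrite -(compA _ (tassoc _ _ _)) tassoc_nat tmap_id !compA.
  rewrite -(compA _ (tmap _ eps')) -tmap_comp comp_idl comp_idr.
  have -> : tmap eps eps' = tmap eps (idm I) \o tmap (idm (N ⊗ M)) eps'.
    by rewrite -tmap_comp comp_idl comp_idr.
  rewrite compA trunit_nat trunit_tens -(tmap_id N M).
  by rewrite -!compA (compA (tassoc N M I)) tassoc_nat !compA.
rewrite 3!tmap_compl !compA E1 tens_pentagon -!compA.
rewrite (compA _ (tmap (bwd _) _)) -tmap_comp fwd_bwd comp_idl tmap_id comp_idl.
rewrite (compA (tassoc _ _ _)) tassoc_nat.
have -> : tmap (bwd (trunit N)) (idm M) =
    bwd (tassoc N I M) \o tmap (idm N) (bwd (tlunit M)).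
  apply: (iso_mono (i := iso_tens (trunit N) (iso_id M))) => /=.
  rewrite -tmap_comp comp_idl fwd_bwd tmap_id -tens_triangle !compA.
  by rewrite -(compA _ (tassoc _ _ _)) fwd_bwd comp_idr -tmap_compr fwd_bwd
    tmap_id.
rewrite -!compA (compA (tassoc N I M)) fwd_bwd comp_idl -!tmap_comp !comp_idl.
by rewrite !compA T tmap_id comp_idr.
Qed.

(** By [counit_mate], the composite of the two comparison maps collapses to a
    triangle composite of the first duality. *)
Lemma dual_comparison_id M N N' (eta : I ~> M ⊗ N) (eps : N ⊗ M ~> I)
  (eta' : I ~> M ⊗ N') (eps' : N' ⊗ M ~> I) :
  tlunit N \o tmap eps (idm N) \o bwd (tassoc N M N) \o tmap (idm N) eta
    \o bwd (trunit N) = idm N ->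
  trunit M \o tmap (idm M) eps' \o tassoc M N' M \o tmap eta' (idm M)
    \o bwd (tlunit M) = idm M ->
  (tlunit N \o tmap eps' (idm N) \o bwd (tassoc N' M N) \o tmap (idm N') eta
    \o bwd (trunit N')) \o
  (tlunit N' \o tmap eps (idm N') \o bwd (tassoc N M N') \o tmap (idm N) eta'
    \o bwd (trunit N)) = idm N.
Proof.
move=> T2 /(counit_mate eps) E.
set f := tlunit N' \o _ \o _ \o _ \o _ in E *. clearbody f.
have Er : bwd (trunit N') \o f = tmap f (idm I) \o bwd (trunit N).
  apply: (iso_mono (i := trunit N')).
  by rewrite !compA fwd_bwd comp_idl trunit_nat -compA fwd_bwd comp_idr.
have Ea : bwd (tassoc N' M N) \o tmap f (idm (M ⊗ N)) =
    tmap (tmap f (idm M)) (idm N) \o bwd (tassoc N M N).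
  apply: (iso_mono (i := tassoc N' M N)).
  by rewrite !compA fwd_bwd comp_idl tassoc_nat tmap_id -compA fwd_bwd comp_idr.
rewrite -[LHS]compA Er -!compA (compA (tmap (idm N') eta)) -tmap_comp.
rewrite comp_idl comp_idr -[f in LHS]comp_idr -[eta in LHS]comp_idl tmap_comp.
rewrite !compA -(compA _ (bwd _) (tmap f _)) Ea !compA.
by rewrite -(compA _ (tmap eps' _)) -tmap_compl E.
Qed.

Lemma dual_unique (M N N' : V) :
  is_dual M N -> is_dual M N' -> inhabited (iso N N').
Proof.
move=> [eta [eps [T1 T2]]] [eta' [eps' [T1' T2']]].
constructor; exact: (Iso (dual_comparison_id T2 T1') (dual_comparison_id T2' T1)).
Qed.

End Duals.

(** * The total category of an indexed category *)

(** The pasting behind associativity of composition in the total category,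
    stated for arbitrary maps because rewriting with associativity inside the
    fibres would also reassociate the maps of the base on which their objects
    depend. *)
Lemma paste_assoc (D : category) (x0 x1 x2 x3 x4 x5 x6 x7 : D)
  (u : x0 ~> x1) (a : x1 ~> x2) (b : x2 ~> x3) (c : x3 ~> x4) (r2 : x4 ~> x5)
  (b' : x6 ~> x7) (r3 : x3 ~> x7) (r3' : x2 ~> x6) (y : D) (r1 : x7 ~> y)
  (e : y ~> x5) :
  r2 \o c = e \o (r1 \o r3) -> r3 \o b = b' \o r3' ->
  e \o (r1 \o (b' \o (r3' \o (a \o u)))) = r2 \o (c \o (b \o a) \o u).
Proof.
by move=> H N; rewrite (compA b') -N -!compA (compA r3) !compA H -!compA.
Qed.

Section Total.
Variables (S : category) (C : indexed_smcat S).

Local Notation "f ^*" := (re C f) (at level 2, format "f ^*").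

Record tot := Tot { tbase : S; tfib : C tbase }.

Record thom (X Y : tot) := THom {
  hbase : tbase X ~> tbase Y;
  hover : tfib X ~> hbase^* (tfib Y)
}.

Lemma thom_eq (X Y : tot) (f g : tbase X ~> tbase Y) (e : f = g)
  (u : tfib X ~> f^* (tfib Y)) (v : tfib X ~> g^* (tfib Y)) :
  re_eq e (tfib Y) \o u = v -> THom u = THom v.
Proof. by case: g / e v => v; rewrite comp_idl => <-. Qed.

(** Uniqueness of identity proofs for maps of the base enters here. *)
Lemma thom_inj (X Y : tot) (f : tbase X ~> tbase Y)
  (u v : tfib X ~> f^* (tfib Y)) : THom u = THom v -> u = v.
Proof.
move=> E; have := f_equal
  (fun h : thom X Y => existT (fun f => tfib X ~> f^* (tfib Y)) _ (hover h)) E.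
exact: inj_pair2.
Qed.

Definition thom_id (X : tot) : thom X X := @THom X X (idm _) (bwd (re1 (tfib X))).

Definition thom_comp (X Y Z : tot) (g : thom Y Z) (f : thom X Y) : thom X Z :=
  @THom X Z (hbase g \o hbase f)
    (re2 (hbase f) (hbase g) (tfib Z) \o (fmap (hbase f)^* (hover g) \o hover f)).

Lemma re2_nat (A B D : S) (f : A ~> B) (g : B ~> D) (M N : C D) (v : M ~> N) :
  re2 f g N \o fmap f^* (fmap g^* v) = fmap (g \o f)^* v \o re2 f g M.
Proof. exact: (mniso_nat (re_comp C f g)). Qed.

Lemma re1_nat (A : S) (M N : C A) (v : M ~> N) :
  re1 N \o fmap (idm A)^* v = v \o re1 M.
Proof. exact: (mniso_nat (re_id C A)). Qed.

Lemma thom_idl (X Y : tot) (f : thom X Y) : thom_comp (thom_id Y) f = f.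
Proof.
case: f => f u; apply: (thom_eq (e := comp_idl f)) => /=.
have H := re_idl f (tfib Y).
by rewrite /re_eq /re2 compA H compA -fmap_comp fwd_bwd fmap_id comp_idl.
Qed.

Lemma thom_idr (X Y : tot) (f : thom X Y) : thom_comp f (thom_id X) = f.
Proof.
case: f => f u; apply: (thom_eq (e := comp_idr f)) => /=.
have H := re_idr f (tfib Y).
by rewrite /re_eq /re2 compA H -/(re1 _) compA re1_nat -compA fwd_bwd comp_idr.
Qed.

Lemma thom_compA (W X Y Z : tot) (h : thom Y Z) (g : thom X Y) (f : thom W X) :
  thom_comp h (thom_comp g f) = thom_comp (thom_comp h g) f.
Proof.
case: h g f => [h w] [g v] [f u]; apply: (thom_eq (e := compA h g f)) => /=.
have H : re2 f (h \o g) (tfib Z) \o fmap f^* (re2 g h (tfib Z)) =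
  re_eq (compA h g f) (tfib Z)
    \o (re2 (g \o f) h (tfib Z) \o re2 f g (h^* (tfib Z)))
  := re_assoc f g h (tfib Z).
have N := re2_nat f g w.
rewrite !fmap_comp; exact: paste_assoc H N.
Qed.

Definition total_cat : category :=
  @Category tot thom thom_id thom_comp thom_idl thom_idr thom_compA.

End Total.

Arguments total_cat : simpl never.

Local Notation "f ^*" := (re _ f) (at level 2, format "f ^*").
Local Notation "M ⊠ N" := (p1^* M ⊗ p2^* N) (at level 34, no associativity).
Local Notation "M ⇝ N" := (@hom (total_cat _) (Tot M) (Tot N))
  (at level 70, no associativity).
Local Notation tid M := (idm (Tot M : total_cat _)).

Section TotalCategory.
Variables (S : category) (C : indexed_smcat S).
Local Notation total := (total_cat C).

(** Associativity at the total category only, so that rewriting with it leaves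
    composites in the base alone. *)
Definition totA := @compA total.

Definition tot_over (A B : S) (M : C A) (N : C B) (f : A ~> B) (u : M ~> f^* N) :
  M ⇝ N := @THom S C (Tot M) (Tot N) f u.

Definition base (X Y : total) (h : X ~> Y) : tbase X ~> tbase Y := hbase h.
Definition over (X Y : total) (h : X ~> Y) : tfib X ~> (base h)^* (tfib Y) :=
  hover h.

Lemma tot_over_eta (A B : S) (M : C A) (N : C B) (h : M ⇝ N) :
  tot_over (over h) = h.
Proof. by case: h. Qed.

Lemma tot_over_inj (A B : S) (M : C A) (N : C B) (f : A ~> B) (u v : M ~> f^* N) :
  tot_over u = tot_over v -> u = v.
Proof. exact: thom_inj. Qed.

Lemma tot_over_eq (A B : S) (M : C A) (N : C B) (f g : A ~> B) (e : f = g)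
  (u : M ~> f^* N) (v : M ~> g^* N) :
  re_eq e N \o u = v -> tot_over u = tot_over v.
Proof. exact: (@thom_eq S C (Tot M) (Tot N) f g e u v). Qed.

Lemma tot_over_comp (A B D : S) (L : C A) (M : C B) (N : C D) (f : A ~> B)
  (g : B ~> D) (u : L ~> f^* M) (v : M ~> g^* N) :
  tot_over v \o tot_over u = tot_over (re2 f g N \o (fmap f^* v \o u)).
Proof. by []. Qed.

Lemma base_comp (X Y Z : total) (g : Y ~> Z) (f : X ~> Y) :
  base (g \o f) = base g \o base f.
Proof. by []. Qed.

Lemma base_id (X : total) : base (idm X) = idm (tbase X).
Proof. by []. Qed.

(** Maps of a fibre, as maps of the total category over an identity. *)
Definition vert (A : S) (M N : C A) (v : M ~> N) :
  M ⇝ N := tot_over (bwd (re1 N) \o v).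

Lemma base_vert (A : S) (M N : C A) (v : M ~> N) : base (vert v) = idm A.
Proof. by []. Qed.

Lemma tot_over_vert (A B : S) (L M : C A) (N : C B) (f : A ~> B) (u : M ~> f^* N)
  (v : L ~> M) : tot_over u \o vert v = tot_over (u \o v).
Proof.
rewrite tot_over_comp; apply: (tot_over_eq (e := comp_idr f)).
have H : re_eq (comp_idr f) N \o re2 (idm A) f N = re1 (f^* N) := re_idr f N.
rewrite compA H compA re1_nat -compA (compA _ _ v) fwd_bwd comp_idl.
by [].
Qed.

Lemma vert_tot_over (A B : S) (L : C A) (M N : C B) (f : A ~> B) (u : L ~> f^* M)
  (v : M ~> N) : vert v \o tot_over u = tot_over (fmap f^* v \o u).
Proof.
rewrite tot_over_comp; apply: (tot_over_eq (e := comp_idl f)).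
have H : re_eq (comp_idl f) N \o re2 f (idm B) N = fmap f^* (re1 N)
  := re_idl f N.
by rewrite compA H fmap_comp compA compA -fmap_comp fwd_bwd fmap_id comp_idl.
Qed.

Lemma vert_id (A : S) (M : C A) : vert (idm M) = tid M.
Proof. by rewrite /vert comp_idr. Qed.

Lemma vert_comp (A : S) (L M N : C A) (v : M ~> N) (u : L ~> M) :
  vert (v \o u) = vert v \o vert u.
Proof. by rewrite {2}/vert tot_over_vert /vert compA. Qed.

Lemma vert_inj (A : S) (M N : C A) (u v : M ~> N) : vert u = vert v -> u = v.
Proof.
move=> /tot_over_inj E.
by rewrite -[u]comp_idl -[v]comp_idl -(fwd_bwd (re1 N)) -!compA E.
Qed.

Lemma vert_of (A : S) (M N : C A) (h : M ⇝ N) :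
  base h = idm A -> exists v : M ~> N, h = vert v.
Proof.
case: h => f u; rewrite /base /= => E; move: u; rewrite /= E => u.
by exists (re1 N \o u); rewrite /vert compA bwd_fwd comp_idl.
Qed.

Lemma vert_iso (A : S) (M N : C A) (i : iso M N) :
  vert (bwd i) \o vert i = tid M.
Proof. by rewrite -vert_comp bwd_fwd vert_id. Qed.

Lemma vert_iso' (A : S) (M N : C A) (i : iso M N) :
  vert i \o vert (bwd i) = tid N.
Proof. by rewrite -vert_comp fwd_bwd vert_id. Qed.

Lemma vert_iso_inv (A : S) (M N : C A) (i : iso M N) :
  vert i \o vert (iso_inv i) = tid N.
Proof. exact: vert_iso'. Qed.

Lemma vert_inv_iso (A : S) (M N : C A) (i : iso M N) :
  vert (iso_inv i) \o vert i = tid M.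
Proof. exact: vert_iso. Qed.

Definition cart (A B : S) (f : A ~> B) (N : C B) :
  (f^* N) ⇝ N := tot_over (idm (f^* N)).

Lemma cart_vert (A B : S) (M : C A) (N : C B) (f : A ~> B) (u : M ~> f^* N) :
  cart f N \o vert u = tot_over u.
Proof. by rewrite tot_over_vert comp_idl. Qed.

Lemma cart_re2 (A B D : S) (f : A ~> B) (g : B ~> D) (N : C D) :
  cart (g \o f) N \o vert (re2 f g N) = cart g N \o cart f (g^* N).
Proof. by rewrite cart_vert tot_over_comp fmap_id comp_idl comp_idr. Qed.

Lemma cart_re_eq (A B : S) (f g : A ~> B) (e : f = g) (N : C B) :
  cart g N \o vert (re_eq e N) = cart f N.
Proof. by case: g / e; rewrite vert_id comp_idr. Qed.

Lemma cart_re1 (A : S) (M : C A) : vert (re1 M) = cart (idm A) M.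
Proof. by rewrite /vert bwd_fwd. Qed.

Lemma cart_fmap (A B : S) (f : A ~> B) (M N : C B) (v : M ~> N) :
  cart f N \o vert (fmap f^* v) = vert v \o cart f M.
Proof. by rewrite cart_vert vert_tot_over comp_idr. Qed.

Lemma cart_re_sq (A B B' D : S) (f : A ~> B) (g : B ~> D) (f' : A ~> B')
  (g' : B' ~> D) (e : g \o f = g' \o f') (M : C D) :
  cart g' M \o cart f' (g'^* M) \o vert (re_sq e M)
    = cart g M \o cart f (g^* M).
Proof.
rewrite /re_sq !vert_comp -cart_re2 -!compA (compA (vert (fwd (re2 f' g' M)))).
by rewrite vert_iso' comp_idl compA cart_re_eq cart_re2.
Qed.

(** * Cartesian maps *)

Definition invertible (D : category) (x y : D) (f : x ~> y) : Prop :=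
  exists g, g \o f = idm x /\ f \o g = idm y.

Lemma invertible_iso (D : category) (x y : D) (i : iso x y) : invertible i.
Proof. by exists (bwd i); rewrite bwd_fwd fwd_bwd. Qed.

Lemma invertible_bwd (D : category) (x y : D) (i : iso x y) :
  invertible (bwd i).
Proof. by exists i; rewrite bwd_fwd fwd_bwd. Qed.

Lemma invertible_comp (D : category) (x y z : D) (f : x ~> y) (g : y ~> z) :
  invertible f -> invertible g -> invertible (g \o f).
Proof.
move=> [f' [H1 H2]] [g' [H3 H4]]; exists (f' \o g').
by split; [exact: comp_cancel H1 H3 | exact: comp_cancel H4 H2].
Qed.

Lemma invertible_of_comp (D : category) (x y z : D) (f : x ~> y)
  (g : y ~> z) : invertible g -> invertible (g \o f) -> invertible f.
Proof.
move=> [g' [H1 H2]] H3.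
rewrite -[f]comp_idl -H1 -compA; apply: invertible_comp => //.
by exists g.
Qed.

Lemma invertible_fmap (D E : category) (F : functor D E) (x y : D)
  (f : x ~> y) : invertible f -> invertible (fmap F f).
Proof.
by move=> [g [H1 H2]]; exists (fmap F g); rewrite -!fmap_comp H1 H2 !fmap_id.
Qed.

(** Over a fixed map of the base, the maps with the universal property of a
    reindexing are those whose fibre component is invertible. *)
Definition cartesian (X Y : total) (h : X ~> Y) : Prop := invertible (over h).

Lemma cartesian_lift (X Y Z : total) (h : Y ~> Z) (k : X ~> Z)
  (f : tbase X ~> tbase Y) :
  cartesian h -> base k = base h \o f ->
  exists l : X ~> Y, base l = f /\ h \o l = k.
Proof.
case: X Y Z h k f => [A L] [B M] [D N] [g b] [k0 u] f.
rewrite /cartesian /base /over /= in b u f * => -[b' [_ Hb]] E.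
move: u; rewrite E => u {k0 E}.
exists (tot_over (fmap f^* b' \o (bwd (re2 f g N) \o u))); split=> //.
rewrite -[LHS]/(tot_over b \o tot_over _) -[RHS]/(tot_over u) tot_over_comp;
  congr tot_over.
rewrite (compA (fmap _ _)) -fmap_comp Hb fmap_id comp_idl compA fwd_bwd.
by rewrite comp_idl.
Qed.

Lemma cartesian_cancel (X Y Z : total) (h : Y ~> Z) (l l' : X ~> Y) :
  cartesian h -> base l = base l' -> h \o l = h \o l' -> l = l'.
Proof.
case: X Y Z h l l' => [A L] [B M] [D N] [g b] [f u] [f' v].
rewrite /cartesian /base /over /= in b u v * => -[b' [Hb _]] E.
case: f' / E v => v.
change (tot_over b \o tot_over u = tot_over b \o tot_over v -> tot_over u =
  tot_over v).
rewrite !tot_over_comp => /tot_over_inj E; congr tot_over.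
have {}E := f_equal (fun w => fmap f^* b' \o (bwd (re2 f g N) \o w)) E.
rewrite !(compA (bwd _)) !bwd_fwd !comp_idl !compA -!fmap_comp Hb in E.
by rewrite fmap_id !comp_idl in E.
Qed.

Lemma cartesian_cart (A B : S) (f : A ~> B) (N : C B) : cartesian (cart f N).
Proof. by exists (idm _); rewrite comp_idl. Qed.

Lemma cartesian_comp (X Y Z : total) (g : Y ~> Z) (f : X ~> Y) :
  cartesian f -> cartesian g -> cartesian (g \o f).
Proof.
case: X Y Z g f => [A L] [B M] [D N] [g b] [f u].
rewrite /cartesian /base /over /= => Hf Hg.
apply: invertible_comp; last exact: invertible_iso.
by apply: invertible_comp => //; exact: invertible_fmap.
Qed.

Lemma cartesian_of_comp (X Y Z : total) (g : Y ~> Z) (f : X ~> Y) :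
  cartesian g -> cartesian (g \o f) -> cartesian f.
Proof.
case: X Y Z g f => [A L] [B M] [D N] [g b] [f u].
rewrite /cartesian /base /over /= => Hg H.
have {}H := invertible_of_comp (invertible_iso _) H.
by apply: invertible_of_comp H; exact: invertible_fmap.
Qed.

Lemma cartesian_vert (A : S) (M N : C A) (v : M ~> N) :
  invertible v -> cartesian (vert v).
Proof. by move=> H; apply: invertible_comp => //; exact: invertible_bwd. Qed.

Lemma cartesian_inverse (X Y : total) (h : X ~> Y) (g : tbase Y ~> tbase X) :
  cartesian h -> g \o base h = idm _ -> base h \o g = idm _ ->
  exists h' : Y ~> X, base h' = g /\ h' \o h = idm X /\ h \o h' = idm Y.
Proof.
move=> Hh H1 H2.
have [h' [Hb Hc]] := cartesian_lift (k := idm Y) Hh (eq_sym H2).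
exists h'; split=> //; split=> //.
apply: (cartesian_cancel Hh); first by rewrite base_comp Hb.
by rewrite compA Hc comp_idl comp_idr.
Qed.

End TotalCategory.

(** * Tensor products of maps over a common map of the base *)

Section FibreTensor.
Variables (S : category) (C : indexed_smcat S).
Local Notation total := (total_cat C).

Definition raw_tens (A B : S) (M N : C A) (M' N' : C B) (f : A ~> B)
  (u : M ~> f^* M') (v : N ~> f^* N') :
  (M ⊗ N) ⇝ (M' ⊗ N') :=
  tot_over (fmu f^* M' N' \o tmap u v).

Lemma re2_fmu (A B D : S) (f : A ~> B) (g : B ~> D) (M N : C D) :
  re2 f g (M ⊗ N) \o (fmap f^* (fmu g^* M N) \o fmu f^* (g^* M) (g^* N))
    = fmu (g \o f)^* M N \o tmap (re2 f g M) (re2 f g N).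
Proof. exact: (mniso_tens (re_comp C f g)). Qed.

(** This is where monoidality of the composition isomorphisms of the
    pseudofunctor is used. *)
Lemma raw_tens_comp (A B D : S) (M N : C A) (M' N' : C B) (M'' N'' : C D)
  (f : A ~> B) (g : B ~> D) (u : M ~> f^* M') (v : N ~> f^* N')
  (u' : M' ~> g^* M'') (v' : N' ~> g^* N'') :
  raw_tens u' v' \o raw_tens u v =
  raw_tens (re2 f g M'' \o (fmap f^* u' \o u))
    (re2 f g N'' \o (fmap f^* v' \o v)).
Proof.
rewrite /raw_tens tot_over_comp; congr tot_over.
rewrite fmap_comp !tmap_comp (compA (fmu _ _ _)) -re2_fmu -!compA.
do 2 f_equal; rewrite !compA; f_equal.
by rewrite fmu_nat.
Qed.

Lemma raw_tens_vert (A : S) (M N M' N' : C A) (u : M ~> M') (v : N ~> N') :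
  vert (tmap u v) = raw_tens (bwd (re1 M') \o u) (bwd (re1 N') \o v).
Proof.
rewrite /vert /raw_tens tmap_comp compA; congr tot_over; f_equal.
have H : re1 (M' ⊗ N') \o fmu (idm A)^* M' N' =
  idm _ \o tmap (re1 M') (re1 N') := mniso_tens (re_id C A) M' N'.
rewrite comp_idl in H.
rewrite -[RHS]comp_idl -(bwd_fwd (re1 (M' ⊗ N'))) -compA (compA (re1 _)) H.
by rewrite -tmap_comp !fwd_bwd tmap_id comp_idr.
Qed.

(** Two maps of the total category have a tensor product as soon as they lie
    over the same map of the base.  Asking for a propositional equality, instead
    of indexing by that map, lets composites of such maps be tensored although
    their base maps agree only up to a proof. *)
Definition over_tens (A B : S) (M N : C A) (M' N' : C B)
  (h : M ⇝ M') (k : N ⇝ N')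
  (e : base k = base h) : (M ⊗ N) ⇝ (M' ⊗ N') :=
  raw_tens (over h) (re_eq e N' \o over k).

Lemma over_tens_tot_over (A B : S) (M N : C A) (M' N' : C B) (f : A ~> B)
  (u : M ~> f^* M') (v : N ~> f^* N')
  (e : base (tot_over v) = base (tot_over u)) :
  over_tens e = raw_tens u v.
Proof. by rewrite /over_tens (UIP_refl _ _ e) /re_eq /= comp_idl. Qed.

Lemma over_tens_eq (A B : S) (M N : C A) (M' N' : C B)
  (h h' : M ⇝ M') (k k' : N ⇝ N')
  (e : base k = base h) (e' : base k' = base h') :
  h = h' -> k = k' -> over_tens e = over_tens e'.
Proof.
move=> Eh Ek; case: h' / Eh e'; case: k' / Ek => e'.
by rewrite (UIP _ _ _ e e').
Qed.

(** Reduces a statement about maps over provably equal base maps to one about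
    a single base map. *)
Lemma over_tensP (A B : S) (M N : C A) (M' N' : C B)
  (h : M ⇝ M') (k : N ⇝ N')
  (e : base k = base h) :
  exists f (u : M ~> f^* M') (v : N ~> f^* N'),
    h = tot_over u /\ k = tot_over v /\ over_tens e = raw_tens u v.
Proof.
case: h k e => [f u] [f' v]; rewrite /base /= in f u f' v * => e.
subst f'; exists f, u, v; split=> //; split=> //.
exact: (@over_tens_tot_over A B M N M' N' f u v eq_refl).
Qed.

Lemma over_tens_comp (A B D : S) (M N : C A) (M' N' : C B) (M'' N'' : C D)
  (h : M ⇝ M') (k : N ⇝ N')
  (h' : M' ⇝ M'') (k' : N' ⇝ N'')
  (e : base k = base h) (e' : base k' = base h')
  (e'' : base (k' \o k) = base (h' \o h)) :
  over_tens e' \o over_tens e = over_tens e''.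
Proof.
have [f [u [v [Eh [Ek E]]]]] := over_tensP e.
have [f' [u' [v' [Eh' [Ek' E']]]]] := over_tensP e'.
rewrite E E' raw_tens_comp; subst h k h' k'.
symmetry; exact: (@over_tens_tot_over A D _ _ _ _ (f' \o f)).
Qed.

Lemma over_tens_vert (A : S) (M N M' N' : C A) (u : M ~> M') (v : N ~> N')
  (e : base (vert v) = base (vert u)) : vert (tmap u v) = over_tens e.
Proof. by rewrite raw_tens_vert over_tens_tot_over. Qed.

Lemma cart_fmu (A B : S) (f : A ~> B) (M N : C B)
  (e : base (cart f N) = base (cart f M)) :
  cart f (M ⊗ N) \o vert (fmu f^* M N) = over_tens e.
Proof. by rewrite over_tens_tot_over cart_vert /raw_tens tmap_id comp_idr. Qed.

Lemma cartesian_over_tens (A B : S) (M N : C A) (M' N' : C B)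
  (h : M ⇝ M') (k : N ⇝ N')
  (e : base k = base h) : cartesian h -> cartesian k -> cartesian (over_tens e).
Proof.
have [f [u [v [Eh [Ek ->]]]]] := over_tensP e.
subst h k => -[u' [Hu Hu']] [v' [Hv Hv']].
apply: invertible_comp; last exact: invertible_iso.
by exists (tmap u' v'); rewrite -!tmap_comp Hu Hu' Hv Hv' !tmap_id.
Qed.

Definition unit_map (A B : S) (f : A ~> B) :
  (tunit (C A)) ⇝ (tunit (C B)) := tot_over (fmu0 f^*).

Lemma base_unit_map (A B : S) (f : A ~> B) : base (unit_map f) = f.
Proof. by []. Qed.

Lemma unit_map_comp (A B D : S) (f : A ~> B) (g : B ~> D) :
  unit_map g \o unit_map f = unit_map (g \o f).
Proof.
rewrite /unit_map tot_over_comp; congr tot_over.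
exact: (mniso_unit (re_comp C f g)).
Qed.

(** Naturality of the associator along maps of the total category combines its
    naturality in a fibre with monoidality of reindexing. *)
Lemma tassoc_over_tens (A B : S) (L M N : C A) (L' M' N' : C B)
  (h : L ⇝ L') (k : M ⇝ M')
  (l : N ⇝ N') (e1 : base k = base h)
  (e2 : base l = base (over_tens e1)) (e3 : base l = base k)
  (e4 : base (over_tens e3) = base h) :
  vert (tassoc L' M' N') \o over_tens e2 = over_tens e4 \o vert (tassoc L M N).
Proof.
have [f [u [v [Eh [Ek E1]]]]] := over_tensP e1; subst h k.
have [f' [v' [w [Ek [El E3]]]]] := over_tensP e3.
have Ef : f = f' := f_equal (fun h => base h) Ek.
subst f'; have {}Ek := tot_over_inj Ek; subst v' l.
have -> : over_tens e2 = raw_tens (fmu f^* L' M' \o tmap u v) w.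
  have -> : over_tens e2 = @over_tens _ _ _ _ _ _ (raw_tens u v) (tot_over w)
    eq_refl.
    exact: over_tens_eq.
  exact: over_tens_tot_over.
have -> : over_tens e4 = raw_tens u (fmu f^* M' N' \o tmap v w).
  have -> : over_tens e4 = @over_tens _ _ _ _ _ _ (tot_over u) (raw_tens v w)
    eq_refl.
    exact: over_tens_eq.
  exact: over_tens_tot_over.
rewrite /raw_tens vert_tot_over tot_over_vert; congr tot_over.
rewrite -{1}[w]comp_idl -{2}[u]comp_idl !tmap_comp !compA fmu_assoc -!compA.
by rewrite tassoc_nat.
Qed.

Lemma tlunit_over_tens (A B : S) (M : C A) (N : C B)
  (h : M ⇝ N) (e : base h = base (unit_map (base h))) :
  vert (tlunit N) \o over_tens e = h \o vert (tlunit M).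
Proof.
case: h e => f u e.
rewrite -[THom _]/(tot_over u) /unit_map (over_tens_tot_over (f := f)) /raw_tens
  vert_tot_over tot_over_vert.
congr tot_over; rewrite -[u in LHS]comp_idl -[X in tmap X _]comp_idr tmap_comp.
by rewrite !compA fmu_lunit tlunit_nat.
Qed.

Lemma trunit_over_tens (A B : S) (M : C A) (N : C B)
  (h : M ⇝ N) (e : base (unit_map (base h)) = base h) :
  vert (trunit N) \o over_tens e = h \o vert (trunit M).
Proof.
case: h e => f u e.
rewrite -[THom _]/(tot_over u) /unit_map (over_tens_tot_over (f := f)) /raw_tens
  vert_tot_over tot_over_vert.
congr tot_over; rewrite -[u in LHS]comp_idl -[X in tmap _ X]comp_idr tmap_comp.
by rewrite !compA fmu_runit trunit_nat.
Qed.

Lemma tbraid_over_tens (A B : S) (M N : C A) (M' N' : C B)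
  (h : M ⇝ M') (k : N ⇝ N')
  (e : base k = base h) (e' : base h = base k) :
  vert (tbraid M' N') \o over_tens e = over_tens e' \o vert (tbraid M N).
Proof.
have [f [u [v [Eh [Ek ->]]]]] := over_tensP e; subst h k.
rewrite (over_tens_tot_over (f := f)) /raw_tens vert_tot_over tot_over_vert;
  congr tot_over.
by rewrite compA fmu_braid -!compA tbraid_nat.
Qed.

End FibreTensor.

(** * External products *)

Section External.
Variables (S : fpcat) (C : indexed_smcat S).
Local Notation total := (total_cat C).

Lemma base_cart (A B : S) (f : A ~> B) (N : C B) : base (cart f N) = f.
Proof. by []. Qed.

(** The factorization of a map through a cartesian one, given by a formula so
    that definitions can use it. *)
Definition cart_lift (A B D : S) (L : C A) (P : C D) (k : L ⇝ P)
  (g : B ~> D) (f : A ~> B) (e : base k = g \o f) :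
  L ⇝ (g^* P) :=
  tot_over (bwd (re2 f g P) \o (re_eq e P \o over k)).

Lemma base_cart_lift (A B D : S) (L : C A) (P : C D)
  (k : L ⇝ P) (g : B ~> D) (f : A ~> B)
  (e : base k = g \o f) : base (cart_lift e) = f.
Proof. by []. Qed.

Lemma cart_cart_lift (A B D : S) (L : C A) (P : C D)
  (k : L ⇝ P) (g : B ~> D) (f : A ~> B)
  (e : base k = g \o f) : cart g P \o cart_lift e = k.
Proof.
rewrite /cart /cart_lift tot_over_comp fmap_id comp_idl compA fwd_bwd comp_idl.
by rewrite -[RHS]tot_over_eta; symmetry; exact: (tot_over_eq (e := e)).
Qed.

Lemma cartesian_cart_lift (A B D : S) (L : C A) (P : C D)
  (k : L ⇝ P) (g : B ~> D) (f : A ~> B)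
  (e : base k = g \o f) : cartesian k -> cartesian (cart_lift e).
Proof.
move=> H; apply: (@cartesian_of_comp _ _ _ _ _ (cart g P)).
  exact: cartesian_cart.
by rewrite cart_cart_lift.
Qed.

(** The pairing of maps with domains in one fibre into an external product,
    over the pairing of their base maps.  The external product of maps, its
    associator and its unitors are all built from it. *)
Definition box_pair (A B D : S) (L L' : C A) (M : C B) (N : C D)
  (h : L ⇝ M) (k : L' ⇝ N) :
  (L ⊗ L') ⇝ (M ⊠ N) :=
  @over_tens S C A (B ** D) L L' (p1^* M) (p2^* N)
    (@cart_lift A (B ** D) B L M h p1 << base h, base k >>
       (eq_sym (p1_pair (base h) (base k))))
    (@cart_lift A (B ** D) D L' N k p2 << base h, base k >>
       (eq_sym (p2_pair (base h) (base k)))) eq_refl.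

Lemma base_box_pair (A B D : S) (L L' : C A) (M : C B) (N : C D)
  (h : L ⇝ M) (k : L' ⇝ N) :
  base (box_pair h k) = << base h, base k >>.
Proof. by []. Qed.

Lemma over_tens_box_pair (A B D : S) (L L' : C A) (M : C B) (N : C D)
  (h : L ⇝ (p1^* M)) (k : L' ⇝ (p2^* N))
  (e : base k = base h) : over_tens e = box_pair (cart p1 M \o h)
    (cart p2 N \o k).
Proof.
apply: over_tens_eq; [apply: (cartesian_cancel (cartesian_cart p1 M)) |
                  apply: (cartesian_cancel (cartesian_cart p2 N))];
  rewrite ?cart_cart_lift // base_cart_lift !base_comp !base_cart;
    apply: pair_ext;
  by rewrite !(p1_pair, p2_pair) ?e.
Qed.

Lemma box_pair_over_tens (X A B D : S) (L L' : C A) (M : C B) (N : C D)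
  (P P' : C X)
  (a : L ⇝ M) (b : L' ⇝ N)
  (h : P ⇝ L) (k : P' ⇝ L')
  (e : base k = base h) :
  box_pair a b \o over_tens e = box_pair (a \o h) (b \o k).
Proof.
rewrite {1}/box_pair; set a' := cart_lift _; set b' := cart_lift _.
have E : base (b' \o k) = base (a' \o h).
  by rewrite !base_comp !base_cart_lift e.
by rewrite (over_tens_comp _ _ E) over_tens_box_pair !totA !cart_cart_lift.
Qed.

Lemma box_pair_vert (A B D : S) (L L' P P' : C A) (M : C B) (N : C D)
  (a : L ⇝ M) (b : L' ⇝ N)
  (u : P ~> L) (v : P' ~> L') :
  box_pair a b \o vert (tmap u v) = box_pair (a \o vert u) (b \o vert v).
Proof.
by rewrite (@over_tens_vert _ _ _ _ _ _ _ u v eq_refl) box_pair_over_tens.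
Qed.

Lemma box_pair_fmu (X A B D : S) (f : X ~> A) (L L' : C A) (M : C B) (N : C D)
  (a : L ⇝ M) (b : L' ⇝ N) :
  box_pair a b \o cart f (L ⊗ L') \o vert (fmu f^* L L') =
  box_pair (a \o cart f L) (b \o cart f L').
Proof. by rewrite -totA (@cart_fmu _ _ _ _ f L L' eq_refl) box_pair_over_tens.
Qed.

Lemma cartesian_box_pair (A B D : S) (L L' : C A) (M : C B) (N : C D)
  (h : L ⇝ M) (k : L' ⇝ N) :
  cartesian h -> cartesian k -> cartesian (box_pair h k).
Proof. by move=> Hh Hk; apply: cartesian_over_tens; exact: cartesian_cart_lift.
  Qed.

Lemma box_pair_id (A B : S) (M : C A) (N : C B) :
  box_pair (cart p1 M) (cart p2 N) = tid (M ⊠ N).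
Proof.
rewrite -[cart p1 M]comp_idr -[cart p2 N]comp_idr.
rewrite -(@over_tens_box_pair _ _ _ _ _ _ _ (idm _) (idm _) eq_refl).
transitivity (vert (idm (p1^* M ⊗ p2^* N))); last exact: vert_id.
rewrite -tmap_id.
rewrite (@over_tens_vert _ _ _ _ _ _ _ (idm (p1^* M)) (idm (p2^* N)) eq_refl).
by apply: over_tens_eq; rewrite vert_id.
Qed.

(** The external product of maps; it lies over the product of base maps by
    definition. *)
Definition box_hom (A B A' B' : S) (M : C A) (N : C B) (M' : C A') (N' : C B')
  (h : M ⇝ M') (k : N ⇝ N') :
  (M ⊠ N) ⇝ (M' ⊠ N') :=
  box_pair (h \o cart p1 M) (k \o cart p2 N).

Lemma base_box_hom (A B A' B' : S) (M : C A) (N : C B) (M' : C A') (N' : C B')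
  (h : M ⇝ M') (k : N ⇝ N') :
  base (box_hom h k) = base h *** base k.
Proof. by []. Qed.

(** Bifunctoriality of the external product is a special case. *)
Lemma box_hom_box_pair (X A B A' B' : S) (P P' : C X) (M : C A) (N : C B)
  (M' : C A')
  (N' : C B') (h : M ⇝ M') (k : N ⇝ N')
  (a : P ⇝ M) (b : P' ⇝ N) :
  box_hom h k \o box_pair a b = box_pair (h \o a) (k \o b).
Proof. by rewrite /box_hom {2}/box_pair box_pair_over_tens -!totA
  !cart_cart_lift. Qed.

Lemma box_hom_comp (A B A' B' A'' B'' : S) (M : C A) (N : C B) (M' : C A')
  (N' : C B') (M'' : C A'') (N'' : C B'')
  (h' : M' ⇝ M'') (k' : N' ⇝ N'')
  (h : M ⇝ M') (k : N ⇝ N') :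
  box_hom h' k' \o box_hom h k = box_hom (h' \o h) (k' \o k).
Proof. by rewrite box_hom_box_pair /box_hom !totA. Qed.

Lemma box_hom_id (A B : S) (M : C A) (N : C B) :
  box_hom (tid M) (tid N) = tid (M ⊠ N).
Proof. by rewrite /box_hom !comp_idl box_pair_id. Qed.

Lemma cartesian_box_hom (A B A' B' : S) (M : C A) (N : C B) (M' : C A')
  (N' : C B') (h : M ⇝ M')
  (k : N ⇝ N') :
  cartesian h -> cartesian k -> cartesian (box_hom h k).
Proof.
by move=> Hh Hk; apply: cartesian_box_pair; apply: cartesian_comp => //;
  exact: cartesian_cart.
Qed.

Lemma vert_box_map (A B : S) (M M' : C A) (N N' : C B) (u : M ~> M')
  (v : N ~> N') : vert (box_map u v) = box_hom (vert u) (vert v).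
Proof.
rewrite /box_map /box_hom -!cart_fmap -box_pair_vert box_pair_id comp_idl //.
Qed.

Lemma cart_box_re (A A' B B' : S) (f : A ~> A') (g : B ~> B') (M : C A')
  (N : C B') :
  cart (f *** g) (M ⊠ N) \o vert (box_re f g M N) =
  box_hom (cart f M) (cart g N).
Proof.
rewrite /box_re vert_comp totA -[cart _ _ in LHS]comp_idl.
rewrite -[X in X \o _ \o _ \o _]box_pair_id box_pair_fmu box_pair_vert.
by rewrite !cart_re_sq.
Qed.

Lemma cart_box_re_l (A A' B : S) (f : A ~> A') (M : C A') (N : C B) :
  cart (f *** idm B) (M ⊠ N) \o vert (box_re_l f M N) =
  box_hom (cart f M) (tid N).
Proof.
rewrite /box_re_l vert_comp totA cart_box_re.
rewrite -[vert _]/(vert (box_map (idm _) (bwd (re1 N)))) vert_box_map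
  box_hom_comp.
by rewrite vert_id comp_idr -cart_re1 vert_iso'.
Qed.

Lemma cart_box_re_r (A B B' : S) (g : B ~> B') (M : C A) (N : C B') :
  cart (idm A *** g) (M ⊠ N) \o vert (box_re_r g M N) =
  box_hom (tid M) (cart g N).
Proof.
rewrite /box_re_r vert_comp totA cart_box_re.
rewrite -[vert _]/(vert (box_map (bwd (re1 M)) (idm _))) vert_box_map
  box_hom_comp.
by rewrite vert_id comp_idr -cart_re1 vert_iso'.
Qed.

(** The associator of the external product, as a map over the rebracketing of
    products in the base. *)
Definition alpha (A B D : S) (M : C A) (N : C B) (P : C D) :
  ((M ⊠ N) ⊠ P) ⇝ (M ⊠ (N ⊠ P)) :=
  box_pair (cart p1 M \o cart p1 (p1^* M))
    (box_pair (cart p2 N \o cart p1 (p2^* N)) (cart p2 P))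
    \o vert (tassoc (p1^* (p1^* M)) (p1^* (p2^* N)) (p2^* P)
             \o tmap (bwd (fmu p1^* (p1^* M) (p2^* N))) (idm (p2^* P))
).

Lemma base_alpha (A B D : S) (M : C A) (N : C B) (P : C D) :
  base (alpha M N P) = prodA A B D.
Proof.
by rewrite /alpha base_comp base_vert !base_box_pair !base_comp !base_cart
  comp_idr.
Qed.

Lemma cart_box_assoc (A B D : S) (M : C A) (N : C B) (P : C D) :
  cart (prodA A B D) (M ⊠ (N ⊠ P)) \o vert (box_assoc M N P) = alpha M N P.
Proof.
rewrite /alpha /box_assoc /box !vert_comp !totA; do 2 f_equal.
rewrite -[cart _ _ in LHS]comp_idl.
rewrite -[X in X \o _ \o _ \o _]box_pair_id box_pair_fmu box_pair_vert.
rewrite cart_re_sq; f_equal.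
rewrite !vert_comp !totA -cart_re2 -(totA _ _ (vert (iso_inv (re2 _ _ _))))
  vert_iso_inv.
rewrite comp_idr -[cart _ _ in LHS]comp_idl.
rewrite -[X in X \o _ \o _ \o _]box_pair_id box_pair_fmu box_pair_vert.
rewrite cart_re_sq; f_equal.
rewrite !vert_comp !totA -cart_re2 -(totA _ _ (vert (iso_inv (re2 _ _ _))))
  vert_iso_inv.
rewrite comp_idr -(cart_re_eq (box_assoc_eq3 A B D)).
by rewrite -totA vert_iso_inv comp_idr.
Qed.

Lemma cartesian_alpha (A B D : S) (M : C A) (N : C B) (P : C D) :
  cartesian (alpha M N P).
Proof.
rewrite -cart_box_assoc; apply: cartesian_comp; last exact: cartesian_cart.
apply: cartesian_vert; exact: invertible_iso.
Qed.

Lemma box_pair_cart (X A B D : S) (f : X ~> A) (L L' : C A) (M : C B) (N : C D)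
  (a : L ⇝ M) (b : L' ⇝ N) :
  box_pair a b \o cart f (L ⊗ L') =
  box_pair (a \o cart f L) (b \o cart f L') \o vert (bwd (fmu f^* L L')).
Proof. by rewrite -box_pair_fmu -!totA vert_iso' comp_idr. Qed.

(** The two associators correspond under pairing: the three maps factor through
    cartesian maps over a common base map, where the fibrewise associator is
    natural. *)
Lemma tassoc_box_pair (X A B D : S) (L L' L'' : C X) (M : C A) (N : C B) (P : C D)
  (a : L ⇝ M) (b : L' ⇝ N)
  (c : L'' ⇝ P) :
  alpha M N P \o box_pair (box_pair a b) c = box_pair a (box_pair b c) \o vert
    (tassoc L L' L'').
Proof.
(* the three maps factor through cartesian maps over this common base map *)
pose f : X ~> (A ** B) ** D := << << base a, base b >>, base c >>.
have [||a' [Ea Ha]] := cartesian_lift (h := cart p1 M \o cart p1 (p1^* M))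
    (k := a) (f := f).
  by apply: cartesian_comp; exact: cartesian_cart.
  by rewrite base_comp !base_cart /f; prod_eq.
have [||b' [Eb Hb]] := cartesian_lift (h := cart p2 N \o cart p1 (p2^* N))
    (k := b) (f := f).
  by apply: cartesian_comp; exact: cartesian_cart.
  by rewrite base_comp !base_cart /f; prod_eq.
have [||c' [Ec Hc]] := cartesian_lift (h := cart p2 P) (k := c) (f := f).
  exact: cartesian_cart.
  by rewrite !base_cart /f; prod_eq.
have Eba : base b' = base a' by rewrite Ea Eb.
have Eca : base c' = base a' by rewrite Ea Ec.
have Ecb : base c' = base b' by rewrite Ec Eb.
have Hab : box_pair a b = cart p1 (M ⊠ N) \o
    (vert (fmu p1^* (p1^* M) (p2^* N)) \o over_tens Eba).
  rewrite totA (@cart_fmu _ _ _ _ p1 (p1^* M) (p2^* N) eq_refl).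
  by rewrite over_tens_box_pair box_pair_over_tens Ha Hb.
pose ab := vert (fmu p1^* (p1^* M) (p2^* N)) \o over_tens Eba.
have Eab : base c' = base ab by rewrite base_comp base_vert comp_idl.
have Hc' : box_pair (box_pair a b) c = over_tens Eab by rewrite
  over_tens_box_pair -Hab Hc.
have Eu : vert (tmap (bwd (fmu p1^* (p1^* M) (p2^* N))) (idm (p2^* P)))
    \o over_tens Eab = over_tens (Eca : base c' = base (over_tens Eba)).
  rewrite (@over_tens_vert _ _ _ _ _ _ _ (bwd (fmu p1^* (p1^* M) (p2^* N)))
    (idm (p2^* P)) eq_refl).
  have e : base (vert (idm (p2^* P)) \o c') =
    base (vert (bwd (fmu p1^* (p1^* M) (p2^* N))) \o ab).
    by rewrite !base_comp Eab.
  rewrite (over_tens_comp _ _ e); apply: over_tens_eq.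
    by rewrite /ab totA vert_iso comp_idl.
  by rewrite vert_id comp_idl.
rewrite Hc' /alpha vert_comp -!totA Eu.
have e4 : base (over_tens Ecb) = base a' := Eba.
by rewrite (tassoc_over_tens _ e4) totA !box_pair_over_tens Ha Hb Hc.
Qed.

Lemma alpha_nat (A B D A' B' D' : S) (M : C A) (N : C B) (P : C D) (M' : C A')
  (N' : C B') (P' : C D') (h : M ⇝ M')
  (k : N ⇝ N') (l : P ⇝ P') :
  alpha M' N' P' \o box_hom (box_hom h k) l =
  box_hom h (box_hom k l) \o alpha M N P.
Proof.
rewrite {1}/box_hom {1}/box_hom box_pair_cart -[X in box_pair _ X]comp_idr
  -vert_id.
rewrite -box_pair_vert totA tassoc_box_pair /alpha totA !box_hom_box_pair -!totA.
by rewrite vert_comp.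
Qed.

(** The unit object of a fibre is cartesian over the unit object of the terminal
    fibre. *)
Definition unit_cart (A : S) : (tunit (C A)) ⇝ (U0 C) :=
  unit_map C (bang A).

(** The unitors of the external product, in the direction in which they are
    maps of the total category over a section of a projection. *)
Definition box_lunit (A : S) (M : C A) : M ⇝ ((U0 C) ⊠ M) :=
  box_pair (unit_cart A) (tid M) \o vert (bwd (tlunit M)).

Definition box_runit (A : S) (M : C A) : M ⇝ (M ⊠ (U0 C)) :=
  box_pair (tid M) (unit_cart A) \o vert (bwd (trunit M)).

Lemma box_lunit_nat (A B : S) (M : C A) (N : C B) (h : M ⇝ N) :
  box_hom (tid (U0 C)) h \o box_lunit M = box_lunit N \o h.
Proof.
have e : base h = base (unit_map C (base h)) by [].
have E : vert (bwd (tlunit N)) \o h = over_tens e \o vert (bwd (tlunit M)).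
  rewrite -[RHS]comp_idl -(vert_iso (tlunit N)) -totA (totA _ (over_tens e)).
  by rewrite tlunit_over_tens -totA vert_iso' comp_idr.
rewrite /box_lunit -[RHS]totA E !totA box_hom_box_pair box_pair_over_tens
  !comp_idl comp_idr.
rewrite /unit_cart unit_map_comp; congr (box_pair (unit_map C _) _ \o _).
exact: bang_uniq.
Qed.

Lemma box_runit_nat (A B : S) (M : C A) (N : C B) (h : M ⇝ N) :
  box_hom h (tid (U0 C)) \o box_runit M = box_runit N \o h.
Proof.
have e : base (unit_map C (base h)) = base h by [].
have E : vert (bwd (trunit N)) \o h = over_tens e \o vert (bwd (trunit M)).
  rewrite -[RHS]comp_idl -(vert_iso (trunit N)) -totA (totA _ (over_tens e)).
  by rewrite trunit_over_tens -totA vert_iso' comp_idr.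
rewrite /box_runit -[RHS]totA E !totA box_hom_box_pair box_pair_over_tens
  !comp_idl comp_idr.
rewrite /unit_cart unit_map_comp; congr (box_pair _ (unit_map C _) \o _).
exact: bang_uniq.
Qed.

Lemma unit_cart_cart (A : S) : unit_cart A \o vert (bwd (fmu0 (bang A)^* )) =
  cart (bang A) (U0 C).
Proof.
by rewrite /unit_cart /unit_map tot_over_vert fwd_bwd.
Qed.

Lemma cartesian_unit_cart (A : S) : cartesian (unit_cart A).
Proof. exact: invertible_iso. Qed.

Lemma cart_box_U_r (A B : S) (M : C (A ** B)) :
  cart ((idm (A ** B) *** bang B) \o diagU2 A B) (M ⊠ (U0 C)) =
  box_runit M \o vert (box_U_r M).
Proof.
rewrite /box_U_r /box_runit; set k := _ \o _; set i := re2 _ _ M >>> _.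
set j := re2 _ _ (U0 C) >>> _.
have Ei : vert i = cart p1 M \o cart k (p1^* M).
  by rewrite /i !vert_comp cart_re1 -cart_re2 cart_re_eq.
have Ej : unit_cart (A ** B) \o vert j = cart p2 (U0 C) \o cart k (p2^* (U0 C)).
  by rewrite /j !vert_comp -cart_re2 !totA unit_cart_cart cart_re_eq.
rewrite !vert_comp !totA -(totA _ _ (vert (trunit M))) vert_iso comp_idr
  box_pair_vert.
rewrite Ej comp_idl Ei -box_pair_fmu box_pair_id comp_idl -totA.
by rewrite vert_iso_inv comp_idr.
Qed.

Lemma cart_box_U_l (A B : S) (M : C (A ** B)) :
  cart ((bang A *** idm (A ** B)) \o diagU A B) ((U0 C) ⊠ M) =
  box_lunit M \o vert (box_U_l M).
Proof.
rewrite /box_U_l /box_lunit; set k := _ \o _; set i := re2 _ _ M >>> _.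
set j := re2 _ _ (U0 C) >>> _.
have Ei : vert i = cart p2 M \o cart k (p2^* M).
  by rewrite /i !vert_comp cart_re1 -cart_re2 cart_re_eq.
have Ej : unit_cart (A ** B) \o vert j = cart p1 (U0 C) \o cart k (p1^* (U0 C)).
  by rewrite /j !vert_comp -cart_re2 !totA unit_cart_cart cart_re_eq.
rewrite !vert_comp !totA -(totA _ _ (vert (tlunit M))) vert_iso comp_idr
  box_pair_vert.
rewrite Ej comp_idl Ei -box_pair_fmu box_pair_id comp_idl -totA.
by rewrite vert_iso_inv comp_idr.
Qed.

End External.

(** * Pushforwards as opcartesian maps *)

Section Opcartesian.
Variables (S : category) (C : indexed_smcat S) (K : pushforwards C).
Local Notation total := (total_cat C).

Local Notation "f `!" := (push K f) (at level 2, format "f `!").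

Definition opcart (A B : S) (f : A ~> B) (M : C A) :
  M ⇝ (f`! M) := tot_over (aunit (push_adj K f) M).

Lemma base_opcart (A B : S) (f : A ~> B) (M : C A) : base (opcart f M) = f.
Proof. by []. Qed.

(** The universal property of an opcartesian map is the adjunction between
    pushforward and reindexing. *)
Lemma opcart_univ (A B : S) (f : A ~> B) (M : C A) (Y : total)
  (k : @hom total (Tot M) Y) (l : B ~> tbase Y) :
  base k = l \o f ->
  exists h : @hom total (Tot (f`! M)) Y, base h = l /\ h \o opcart f M = k.
Proof.
case: Y k l => D N [k u] l; rewrite /base /= in k l u * => E; subst k.
exists (tot_over (acounit (push_adj K f) (l^* N)
            \o fmap f`! (bwd (re2 f l N) \o u))); split=> //.
rewrite -[LHS]/(tot_over _ \o tot_over _) -[RHS]/(tot_over u) tot_over_comp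
  adj_beta; congr tot_over.
by rewrite compA fwd_bwd comp_idl.
Qed.

Lemma opcart_cancel (A B : S) (f : A ~> B) (M : C A) (Y : total)
  (h h' : @hom total (Tot (f`! M)) Y) :
  base h = base h' -> h \o opcart f M = h' \o opcart f M -> h = h'.
Proof.
case: Y h h' => D N [l u] [l' v]; rewrite /base /= in l u l' v * => E; subst l'.
change (tot_over u \o opcart f M = tot_over v \o opcart f M -> tot_over u =
  tot_over v).
rewrite /opcart !tot_over_comp => /tot_over_inj E; congr tot_over.
apply: (adj_ext (a := push_adj K f)).
have {}E := f_equal (comp (bwd (re2 f l N))) E.
by rewrite !(compA (bwd _)) !bwd_fwd !comp_idl in E.
Qed.

Lemma opcart_fmap (A B : S) (f : A ~> B) (M N : C A) (v : M ~> N) :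
  vert (fmap f`! v) \o opcart f M = opcart f N \o vert v.
Proof. by rewrite /opcart vert_tot_over tot_over_vert -aunit_nat. Qed.

Lemma vert_acounit (A B : S) (f : A ~> B) (M : C A) (N : C B)
  (u : M ~> f^* N) :
  vert (acounit (push_adj K f) N \o fmap f`! u) \o opcart f M = tot_over u.
Proof. by rewrite /opcart vert_tot_over adj_beta. Qed.

(** An opcartesian map over an isomorphism is an isomorphism, since it has the
    same universal property as the identity. *)
Lemma opcart_inverse (A B : S) (f : A ~> B) (g : B ~> A) (M : C A) :
  g \o f = idm A -> f \o g = idm B ->
  exists h : (f`! M) ⇝ M,
    base h = g /\ h \o opcart f M = idm _ /\ opcart f M \o h = idm _.
Proof.
move=> H1 H2.
have [h [Hb Hc]] := @opcart_univ _ _ f M (Tot M) (idm _) g (eq_sym H1).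
exists h; split=> //; split=> //.
apply: opcart_cancel; first by rewrite base_comp Hb.
by rewrite -totA Hc comp_idl comp_idr.
Qed.

Lemma vert_bc_map (s : square S) (M : C (sw s)) :
  cart (right s) ((bot s)`! M) \o vert (bc_map K M)
    \o opcart (top s) ((left s)^* M) =
  opcart (bot s) M \o cart (left s) M.
Proof.
have -> : bc_map K M = acounit (push_adj K (top s)) _ \o fmap (top s)`!
    (re_sq (eq_sym (sq_comm s)) ((bot s)`! M)
     \o fmap (left s)^* (aunit (push_adj K (bot s)) M)).
  by rewrite /bc_map fmap_comp compA.
rewrite -totA vert_acounit -cart_vert vert_comp !totA cart_re_sq.
by rewrite -totA cart_fmap totA cart_vert.
Qed.

Lemma proj_opcart (A B : S) (f : A ~> B) (M : C B) (N : C A)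
  (e : base (opcart f N) = base (cart f M)) :
  vert (proj_map K f M N) \o opcart f (f^* M ⊗ N) = over_tens e.
Proof.
have -> : proj_map K f M N = acounit (push_adj K f) _ \o fmap f`!
    (fmu f^* M (f`! N) \o tmap (idm (f^* M)) (aunit (push_adj K f) N)).
  by rewrite /proj_map fmap_comp compA.
by rewrite vert_acounit (over_tens_tot_over (f := f)).
Qed.

(** The comparison of left adjoints is a transpose, so that its value on the
    opcartesian map can be read off. *)
Lemma vert_lau (A B : S) (f : A ~> B) (M : C A)
  (L2 : functor (C A) (C B)) (R2 : functor (C B) (C A))
  (a2 : adjunction L2 R2)
  (r : forall y, iso (f^* y) (R2 y))
  (r_nat : forall y y' (g : y ~> y'), r y' \o fmap f^* g = fmap R2 g \o r y) :
  vert (left_adjoint_unique (push_adj K f) a2 r_nat M) \o opcart f M =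
  tot_over (bwd (r (L2 M)) \o aunit a2 M).
Proof. by rewrite vert_acounit. Qed.

Lemma vert_push_eq (A B : S) (f g : A ~> B) (e : f = g) (M : C A) :
  vert (iso_eq (fun h => h`! M) e) \o opcart f M = opcart g M.
Proof. by case: g / e; rewrite vert_id comp_idl. Qed.

End Opcartesian.

Section Push.
Variables (S : fpcat) (C : indexed_smcat S) (K : indexed_coproducts C).
Local Notation total := (total_cat C).

Local Notation "f `!" := (push K f) (at level 2, format "f `!").

Lemma vert_push_id (A : S) (M : C A) :
  vert (push_id K M) \o opcart K (idm A) M = idm _.
Proof. by rewrite (vert_lau K M (adj_id (C A))) comp_idr. Qed.

Lemma vert_push_comp (A B D : S) (f : A ~> B) (g : B ~> D) (M : C A) :
  vert (push_comp K f g M) \o (opcart K g (f`! M) \o opcart K f M) =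
  opcart K (g \o f) M.
Proof.
have -> : fwd (push_comp K f g M) =
    acounit (push_adj K g) _ \o fmap g`! (acounit (push_adj K f) _
      \o fmap f`! (bwd (re2 f g _) \o aunit (push_adj K (g \o f)) M)).
  by rewrite fmap_comp (@compA (C D)).
rewrite totA vert_acounit -cart_vert -totA vert_acounit -cart_vert vert_comp
  !totA.
by rewrite -cart_re2 -(totA _ _ (vert (bwd _))) vert_iso' comp_idr cart_vert.
Qed.

Lemma vert_bc (s : square S) (r : required_square s) (M : C (sw s)) :
  cart (right s) ((bot s)`! M) \o vert (bc K r M)
    \o opcart K (top s) ((left s)^* M) =
  opcart K (bot s) M \o cart (left s) M.
Proof. exact: vert_bc_map. Qed.

Lemma opcart_iso_map (A B : S) (f : A ~> B) (M N : C A) (i : iso M N) :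
  vert (iso_map f`! i) \o opcart K f M = opcart K f N \o vert i.
Proof. exact: opcart_fmap. Qed.

Lemma cart_re_eq_re2 (A B D : S) (f : A ~> B) (g : B ~> D) (h : A ~> D)
  (e : g \o f = h) (N : C D) :
  cart g N \o (cart f (g^* N) \o vert (iso_inv (re2 f g N >>> re_eq e N))) =
  cart h N.
Proof.
rewrite totA -cart_re2 -(cart_re_eq e).
have -> : cart h N \o vert (re_eq e N) \o vert (re2 f g N) =
  cart h N \o vert (re2 f g N >>> re_eq e N) by rewrite vert_comp totA.
by rewrite -totA vert_iso_inv comp_idr.
Qed.

(** In both factors the projection formula acts by a pairing; the Beck-Chevalley
    isomorphism then turns the opcartesian map on one factor into the one that
    is wanted.  For [box_push_l] two braidings cancel in addition. *)
Lemma vert_box_push_r (A B D : S) (f : A ~> B) (P : C D) (M : C A) :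
  vert (box_push_r K f P M) \o opcart K (idm D *** f) (P ⊠ M) =
  box_hom (tid P) (opcart K f M).
Proof.
rewrite /box_push_r /box; do 2 rewrite vert_comp.
set F := idm D *** f.
set t := iso_inv _; rewrite -!totA opcart_iso_map.
have e : base (opcart K F (p2^* M)) = base (cart F (p1^* P)) by [].
rewrite (totA _ (opcart K F _)) (proj_opcart e).
pose X := cart F (p1^* P) \o vert t.
have eX : base (opcart K F (p2^* M)) = base X by rewrite base_comp base_vert
  comp_idr.
have -> : over_tens e \o vert (iso_tens t (iso_id (p2^* M))) = over_tens eX.
  rewrite (@over_tens_vert _ _ _ _ _ _ _ t (idm (p2^* M)) eq_refl).
  have e' : base (opcart K F (p2^* M) \o vert (idm (p2^* M))) = base X.
    by rewrite vert_id comp_idr.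
  rewrite (over_tens_comp _ _ e'); apply: over_tens_eq => //.
  by rewrite vert_id comp_idr.
rewrite (@over_tens_vert _ _ _ _ _ _ _ (idm _) (bc K (sq_pr_required D f) M)
  eq_refl).
have e' : base (vert (bc K (sq_pr_required D f) M) \o opcart K F (p2^* M)) =
  base (vert (idm (p1^* P)) \o X) by rewrite vert_id comp_idl -eX;
    exact: comp_idl.
have Ebc : cart p2 (f`! M) \o vert (bc K (sq_pr_required D f) M)
    \o opcart K F (p2^* M) = opcart K f M \o cart p2 M
  := vert_bc (sq_pr_required D f) M.
rewrite (over_tens_comp _ _ e') over_tens_box_pair /box_hom vert_id !comp_idl.
by congr (box_pair _ _); [exact: cart_re_eq_re2 | rewrite totA].
Qed.

Lemma vert_box_push_l (A B D : S) (f : A ~> B) (M : C A) (P : C D) :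
  vert (box_push_l K f M P) \o opcart K (f *** idm D) (M ⊠ P) =
  box_hom (opcart K f M) (tid P).
Proof.
rewrite /box_push_l /box; do 4 rewrite vert_comp.
set F := f *** idm D.
set t := iso_inv _; rewrite -!totA opcart_iso_map (totA _ (opcart K F _))
  opcart_iso_map.
have e : base (opcart K F (p1^* M)) = base (cart F (p2^* P)) by [].
rewrite -(totA (opcart K F _)) (totA _ (opcart K F _)) (proj_opcart e).
pose X := cart F (p2^* P) \o vert t.
have eX : base (opcart K F (p1^* M)) = base X by rewrite base_comp base_vert
  comp_idr.
rewrite (totA (over_tens e)).
have -> : over_tens e \o vert (iso_tens t (iso_id (p1^* M))) = over_tens eX.
  rewrite (@over_tens_vert _ _ _ _ _ _ _ t (idm (p1^* M)) eq_refl).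
  have e' : base (opcart K F (p1^* M) \o vert (idm (p1^* M))) = base X.
    by rewrite vert_id comp_idr.
  rewrite (over_tens_comp _ _ e'); apply: over_tens_eq => //.
  by rewrite vert_id comp_idr.
have eX' : base X = base (opcart K F (p1^* M)) := eq_sym eX.
rewrite (totA _ (over_tens eX)) (tbraid_over_tens eX eX') -totA -vert_comp.
rewrite (bwd_fwd (braid_iso (p1^* M) (p2^* P))) vert_id comp_idr.
rewrite (@over_tens_vert _ _ _ _ _ _ _ (bc K (sq_pl_required D f) M) (idm _)
  eq_refl).
have e' : base (vert (idm (p2^* P)) \o X) =
  base (vert (bc K (sq_pl_required D f) M) \o opcart K F (p1^* M)).
  by rewrite vert_id comp_idl -eX; symmetry; exact: comp_idl.
have Ebc : cart p1 (f`! M) \o vert (bc K (sq_pl_required D f) M)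
    \o opcart K F (p1^* M) = opcart K f M \o cart p1 M
  := vert_bc (sq_pl_required D f) M.
rewrite (over_tens_comp _ _ e') over_tens_box_pair /box_hom vert_id !comp_idl.
by congr (box_pair _ _); [rewrite totA | exact: cart_re_eq_re2].
Qed.

End Push.

(** * Composition, associator and unitors in the total category *)

Section Composition.
Variables (S : fpcat) (C : indexed_smcat S) (K : indexed_coproducts C).
Local Notation total := (total_cat C).

Local Notation "f `!" := (push K f) (at level 2, format "f `!").
Local Notation "M ⊙ N" := ((mid_out _ _ _)`! ((mid_diag _ _ _)^* (M ⊠ N)))
  (at level 34, no associativity).

Lemma opcart_odot_map (A B D : S) (M M' : C (A ** B)) (N N' : C (B ** D))
  (u : M ~> M') (v : N ~> N') :
  vert (odot_map K u v) \o opcart K (mid_out A B D) ((mid_diag A B D)^* (M ⊠ N)) =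
  opcart K (mid_out A B D) ((mid_diag A B D)^* (M' ⊠ N'))
    \o vert (fmap (mid_diag A B D)^* (box_map u v)).
Proof. exact: opcart_fmap. Qed.

Lemma vert_iso_comp (A : S) (L M N : C A) (i : iso L M) (k : iso M N) :
  vert (i >>> k) = vert k \o vert i.
Proof. exact: vert_comp. Qed.

Lemma cart_box_map (A B X : S) (f : X ~> A ** B) (M M' : C A) (N N' : C B)
  (u : M ~> M') (v : N ~> N') :
  cart f (M' ⊠ N') \o vert (fmap f^* (box_map u v)) =
  box_hom (vert u) (vert v) \o cart f (M ⊠ N).
Proof. by rewrite cart_fmap vert_box_map. Qed.

(** The form in which Beck-Chevalley isomorphisms occur in the associator and
    the unitors: reindex an isomorphism with a pushforward, then exchange. *)
Lemma bc_transpose (q : square S) (r : required_square q) (W : C (sw q))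
  (Y : C (se q))
  (y : iso Y ((bot q)`! W)) (T : total) (v : T ~> Tot ((left q)^* W))
  (s : T ~> Tot ((right q)^* Y)) :
  base s = top q \o base v ->
  vert y \o (cart (right q) Y \o s) = opcart K (bot q) W
    \o (cart (left q) W \o v) ->
  vert (iso_map (right q)^* y >>> iso_inv (bc K r W)) \o s =
  opcart K (top q) ((left q)^* W) \o v.
Proof.
move=> Es Hs; rewrite vert_comp.
have H : vert (iso_map (right q)^* y) \o s =
    vert (bc K r W) \o (opcart K (top q) ((left q)^* W) \o v).
  apply: (cartesian_cancel (cartesian_cart _ _)).
    by rewrite !base_comp !base_vert !comp_idl Es.
  by rewrite !totA vert_bc cart_fmap -!totA.
by rewrite -totA H totA vert_inv_iso comp_idl.
Qed.

Section Left.
Variables (A B D E : S) (M : C (A ** B)) (N : C (B ** D)) (P : C (D ** E)).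

Let T := (mid_diag2 A B D E)^* (M ⊠ (N ⊠ P)).

(** [t] and [s] are the two stages in which the apex of the threefold span maps
    to the external product of the iterated composite; through them the
    comparison of the iterated composite with the threefold one is the identity
    on the apex. *)
Lemma odot3_l_opcart
  (t : T ⇝ (((mid_diag A B D)^* (M ⊠ N)) ⊠ P))
  (s : T ⇝ ((mid_diag A D E)^* ((M ⊙ N) ⊠ P))) :
  base t = diagL A B D E -> base s = outL A B D E ->
  alpha M N P \o box_hom (cart (mid_diag A B D) (M ⊠ N)) (tid P) \o t =
    cart (mid_diag2 A B D E) (M ⊠ (N ⊠ P)) ->
  cart (mid_diag A D E) ((M ⊙ N) ⊠ P) \o s =
    box_hom (opcart K (mid_out A B D) ((mid_diag A B D)^* (M ⊠ N))) (tid P) \o t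
      ->
  vert (odot3_l K M N P) \o (opcart K (mid_out A D E) _ \o s) =
  opcart K (mid_out2 A B D E) T.
Proof.
move=> Et Es Ht Hs; rewrite /odot3_l /odot /box; do 3 rewrite vert_comp.
set w := box_re_l _ _ _ >>> _; set j := re2 _ _ _ >>> _.
set b := bc _ _ _; set y := iso_inv (box_push_l _ _ _ _) >>> _.
set Q := (diagL A B D E)^* _ in b j *.
set F := mid_out A B D *** idm (D ** E) in b y *.
rewrite -!totA (totA _ (opcart K (mid_out A D E) _)) opcart_iso_map.
have Hj : cart (mid_diag2 A B D E) (M ⊠ (N ⊠ P)) \o vert j =
  cart (prodA _ _ _) (M ⊠ (N ⊠ P)) \o cart (mid_diag A B D *** idm _) _
    \o cart (diagL A B D E) _.
  by rewrite /j 2!vert_comp !totA cart_re_eq cart_re2 -[LHS]totA cart_re2 totA.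
have Hw : vert w \o t = cart (diagL A B D E) _ \o vert (iso_inv j).
  apply: (cartesian_cancel (cartesian_comp (cartesian_cart _ _)
            (cartesian_cart (prodA _ _ _) (M ⊠ (N ⊠ P))))).
    by rewrite !base_comp !base_vert comp_idl comp_idr Et.
  rewrite [RHS]totA -Hj -[RHS]totA vert_iso_inv comp_idr -Ht [LHS]totA; congr
    (_ \o _).
  rewrite /w vert_comp -cart_box_assoc -cart_box_re_l !totA; congr (_ \o _).
  by rewrite -!totA; congr (_ \o _); exact: cart_fmap.
have Hy : vert y \o box_hom (opcart K (mid_out A B D) _) (tid P) =
    opcart K F _ \o vert w.
  rewrite /y vert_comp -opcart_iso_map -vert_box_push_l -totA.
  by rewrite (totA _ _ (opcart _ _ _)) vert_inv_iso comp_idl.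
have Hyw : vert y \o (box_hom (opcart K (mid_out A B D) _) (tid P) \o t) =
    opcart K F _ \o (cart (diagL A B D E) _ \o vert (iso_inv j)).
  by rewrite (totA (vert y)) Hy -totA Hw.
rewrite -!totA; set x := _ >>> iso_inv b.
have Hx : vert x \o s = opcart K (outL A B D E) Q \o vert (iso_inv j).
  apply: (bc_transpose (q := sq_L A B D E)).
    by rewrite base_vert comp_idr.
  transitivity (vert y \o (box_hom (opcart K (mid_out A B D) _) (tid P) \o t));
    last exact: Hyw.
  by congr (_ \o _).
transitivity (vert (iso_map (mid_out2 A B D E)`! j)
  \o (vert (push_eq K (outL_eq A B D E) Q)
  \o (vert (push_comp K (outL A B D E) (mid_out A D E) Q)
  \o (opcart K (mid_out A D E) ((outL A B D E)`! Q)
  \o (opcart K (outL A B D E) Q \o vert (iso_inv j)))))).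
  by do 4 congr (_ \o _).
rewrite (totA (opcart K (mid_out A D E) _)) (totA (vert (push_comp _ _ _ _))).
rewrite vert_push_comp (totA (vert (push_eq _ _ _))) vert_push_eq.
by rewrite totA opcart_iso_map -totA vert_iso_inv comp_idr.
Qed.

End Left.
Section Right.
Variables (A B D E : S) (M : C (A ** B)) (N : C (B ** D)) (P : C (D ** E)).

Let T := (mid_diag2 A B D E)^* (M ⊠ (N ⊠ P)).

Lemma odot3_r_opcart
  (t : T ⇝ (M ⊠ ((mid_diag B D E)^* (N ⊠ P))))
  (s : T ⇝ ((mid_diag A B E)^* (M ⊠ (N ⊙ P)))) :
  base t = diagR A B D E -> base s = outR A B D E ->
  box_hom (tid M) (cart (mid_diag B D E) (N ⊠ P)) \o t =
    cart (mid_diag2 A B D E) (M ⊠ (N ⊠ P)) ->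
  cart (mid_diag A B E) (M ⊠ (N ⊙ P)) \o s =
    box_hom (tid M) (opcart K (mid_out B D E) ((mid_diag B D E)^* (N ⊠ P))) \o t
      ->
  vert (odot3_r K M N P) \o (opcart K (mid_out A B E) _ \o s) =
  opcart K (mid_out2 A B D E) T.
Proof.
move=> Et Es Ht Hs; rewrite /odot3_r /odot /box; do 3 rewrite vert_comp.
set w := box_re_r _ _ _; set j := re2 _ _ _ >>> _.
set b := bc _ _ _; set y := iso_inv (box_push_r _ _ _ _) >>> _.
set Q := (diagR A B D E)^* _ in b j *.
set F := idm (A ** B) *** mid_out B D E in b y *.
rewrite -!totA (totA _ (opcart K (mid_out A B E) _)) opcart_iso_map.
have Hj : cart (mid_diag2 A B D E) (M ⊠ (N ⊠ P)) \o vert j =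
  cart (idm (A ** B) *** mid_diag B D E) _ \o cart (diagR A B D E) _.
  by rewrite /j vert_comp !totA cart_re_eq cart_re2.
have Hw : vert w \o t = cart (diagR A B D E) _ \o vert (iso_inv j).
  apply: (cartesian_cancel (cartesian_cart _ _)).
    by rewrite !base_comp !base_vert comp_idl comp_idr Et.
  by rewrite [RHS]totA -Hj -[RHS]totA vert_iso_inv comp_idr -Ht totA
    cart_box_re_r.
have Hy : vert y \o box_hom (tid M) (opcart K (mid_out B D E) _) =
    opcart K F _ \o vert w.
  rewrite /y vert_comp -opcart_iso_map -vert_box_push_r -totA.
  by rewrite (totA _ _ (opcart _ _ _)) vert_inv_iso comp_idl.
have Hyw : vert y \o (box_hom (tid M) (opcart K (mid_out B D E) _) \o t) =
    opcart K F _ \o (cart (diagR A B D E) _ \o vert (iso_inv j)).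
  by rewrite (totA (vert y)) Hy -totA Hw.
rewrite -!totA; set x := _ >>> iso_inv b.
have Hx : vert x \o s = opcart K (outR A B D E) Q \o vert (iso_inv j).
  apply: (bc_transpose (q := sq_R A B D E)).
    by rewrite base_vert comp_idr.
  transitivity (vert y \o (box_hom (tid M) (opcart K (mid_out B D E) _) \o t));
    last exact: Hyw.
  by congr (_ \o _).
transitivity (vert (iso_map (mid_out2 A B D E)`! j)
  \o (vert (push_eq K (outR_eq A B D E) Q)
  \o (vert (push_comp K (outR A B D E) (mid_out A B E) Q)
  \o (opcart K (mid_out A B E) ((outR A B D E)`! Q)
  \o (opcart K (outR A B D E) Q \o vert (iso_inv j)))))).
  by do 4 congr (_ \o _).
rewrite (totA (opcart K (mid_out A B E) _)) (totA (vert (push_comp _ _ _ _))).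
rewrite vert_push_comp (totA (vert (push_eq _ _ _))) vert_push_eq.
by rewrite totA opcart_iso_map -totA vert_iso_inv comp_idr.
Qed.

End Right.

(** Both bracketings are compared through the threefold composite, on which
    they induce the same opcartesian map. *)
Lemma odot_assoc_opcart (A B D E : S) (M : C (A ** B)) (N : C (B ** D))
  (P : C (D ** E))
  (T := (mid_diag2 A B D E)^* (M ⊠ (N ⊠ P)))
  (t : T ⇝ (((mid_diag A B D)^* (M ⊠ N)) ⊠ P))
  (s : T ⇝ ((mid_diag A D E)^* ((M ⊙ N) ⊠ P)))
  (t' : T ⇝ (M ⊠ ((mid_diag B D E)^* (N ⊠ P))))
  (s' : T ⇝ ((mid_diag A B E)^* (M ⊠ (N ⊙ P)))) :
  base t = diagL A B D E -> base s = outL A B D E ->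
  alpha M N P \o box_hom (cart (mid_diag A B D) (M ⊠ N)) (tid P) \o t =
    cart (mid_diag2 A B D E) (M ⊠ (N ⊠ P)) ->
  cart (mid_diag A D E) ((M ⊙ N) ⊠ P) \o s =
    box_hom (opcart K (mid_out A B D) ((mid_diag A B D)^* (M ⊠ N))) (tid P) \o t
      ->
  base t' = diagR A B D E -> base s' = outR A B D E ->
  box_hom (tid M) (cart (mid_diag B D E) (N ⊠ P)) \o t' =
    cart (mid_diag2 A B D E) (M ⊠ (N ⊠ P)) ->
  cart (mid_diag A B E) (M ⊠ (N ⊙ P)) \o s' =
    box_hom (tid M) (opcart K (mid_out B D E) ((mid_diag B D E)^* (N ⊠ P))) \o t'
      ->
  vert (odot_assoc K M N P) \o (opcart K (mid_out A D E) _ \o s) =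
    opcart K (mid_out A B E) _ \o s' /\
  vert (bwd (odot_assoc K M N P)) \o (opcart K (mid_out A B E) _ \o s') =
    opcart K (mid_out A D E) _ \o s.
Proof.
move=> H1 H2 H3 H4 H5 H6 H7 H8.
have E1 := odot3_l_opcart H1 H2 H3 H4; have E2 := odot3_r_opcart H5 H6 H7 H8.
have E3 : vert (odot_assoc K M N P) \o (opcart K (mid_out A D E) _ \o s) =
    opcart K (mid_out A B E) _ \o s'.
  rewrite /odot_assoc vert_comp -totA.
  transitivity (vert (iso_inv (odot3_r K M N P)) \o opcart K (mid_out2 A B D E)
    T).
    by congr (_ \o _).
  by rewrite -E2 totA vert_inv_iso comp_idl.
split=> //; rewrite -E3 totA.
transitivity (tid ((M ⊙ N) ⊙ P) \o (opcart K (mid_out A D E) _ \o s));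
  last exact: comp_idl.
by congr (_ \o _); exact: vert_iso.
Qed.

Section Units.
Variables (A B : S) (M : C (A ** B)).

(** [opcart \o s] is the inverse of the unitor, as a map out of [M]; [r] and [s]
    are determined by the two equations. *)
Lemma odot_runit_opcart
  (r : M ⇝ (M ⊠ ((bang B)^* (U0 C))))
  (s : M ⇝ ((mid_diag A B B)^*
         (M ⊠ ((diag B)`! ((bang B)^* (U0 C)))))) :
  base r = diagU2 A B -> base s = diagU1 A B ->
  box_hom (tid M) (cart (bang B) (U0 C)) \o r = box_runit M ->
  cart (mid_diag A B B) _ \o s = box_hom (tid M) (opcart K (diag B) _) \o r ->
  vert (odot_runit K M) \o (opcart K (mid_out A B B) _ \o s) = tid M.
Proof.
move=> Er Es Hr Hs; rewrite /odot_runit /odot /odot_unit.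
move: (box_U_r M) (cart_box_U_r M) => u Hu; rewrite /box in u Hu *; do 5 rewrite
  vert_iso_comp.
set w := box_re_r _ _ _; set b := bc _ _ _.
set y := iso_inv (box_push_r _ _ _ _) >>> _.
set Q := (diagU2 A B)^* _ in b *; set F := idm (A ** B) *** diag B in b y *.
set j := re2 (diagU2 A B) _ _ >>> u.
rewrite -!totA (totA _ (opcart K (mid_out A B B) _)) opcart_iso_map.
have Hj : box_runit M \o vert j =
  cart (idm (A ** B) *** bang B) _ \o cart (diagU2 A B) _.
  by rewrite /j vert_comp totA -Hu cart_re2.
have Hw : vert w \o r = cart (diagU2 A B) _ \o vert (iso_inv j).
  apply: (cartesian_cancel (cartesian_cart _ _)).
    by rewrite !base_comp !base_vert comp_idl comp_idr Er.
  by rewrite [RHS]totA -Hj -[RHS]totA vert_iso_inv comp_idr -Hr totA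
    cart_box_re_r.
have Hy : vert y \o box_hom (tid M) (opcart K (diag B) _) =
    opcart K F _ \o vert w.
  rewrite /y vert_comp -opcart_iso_map -vert_box_push_r -totA.
  by rewrite (totA _ _ (opcart _ _ _)) vert_inv_iso comp_idl.
have Hyw : vert y \o (box_hom (tid M) (opcart K (diag B) _) \o r) =
    opcart K F _ \o (cart (diagU2 A B) _ \o vert (iso_inv j)).
  by rewrite (totA (vert y)) Hy -totA Hw.
rewrite -!totA; set x := _ >>> iso_inv b.
have Hx : vert x \o s = opcart K (diagU1 A B) Q \o vert (iso_inv j).
  apply: (bc_transpose (q := sq_ru A B)).
    by rewrite base_vert comp_idr.
  transitivity (vert y \o (box_hom (tid M) (opcart K (diag B) _) \o r)); last
    exact: Hyw.
  by congr (_ \o _).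
transitivity (vert j \o (vert (push_id K Q)
  \o (vert (push_eq K (out_diagU1 A B) Q)
  \o (vert (push_comp K (diagU1 A B) (mid_out A B B) Q)
  \o (opcart K (mid_out A B B) ((diagU1 A B)`! Q)
  \o (opcart K (diagU1 A B) Q \o vert (iso_inv j))))))).
  rewrite /j vert_iso_comp -totA.
  by do 6 congr (_ \o _).
rewrite (totA (opcart K (mid_out A B B) _)) (totA (vert (push_comp _ _ _ _))).
rewrite vert_push_comp (totA (vert (push_eq _ _ _))) vert_push_eq.
by rewrite (totA _ (opcart K (idm (A ** B)) Q)) vert_push_id comp_idl
  vert_iso_inv.
Qed.

Lemma odot_lunit_opcart
  (r : M ⇝ (((bang A)^* (U0 C)) ⊠ M))
  (s : M ⇝ ((mid_diag A A B)^*
         (((diag A)`! ((bang A)^* (U0 C))) ⊠ M))) :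
  base r = diagU A B -> base s = diagU A B ->
  box_hom (cart (bang A) (U0 C)) (tid M) \o r = box_lunit M ->
  cart (mid_diag A A B) _ \o s = box_hom (opcart K (diag A) _) (tid M) \o r ->
  vert (odot_lunit K M) \o (opcart K (mid_out A A B) _ \o s) = tid M.
Proof.
move=> Er Es Hr Hs; rewrite /odot_lunit /odot /odot_unit.
move: (box_U_l M) (cart_box_U_l M) => u Hu; rewrite /box in u Hu *; do 5 rewrite
  vert_iso_comp.
set w := box_re_l _ _ _; set b := bc _ _ _.
set y := iso_inv (box_push_l _ _ _ _) >>> _.
set Q := (diagU A B)^* _ in b *; set F := diag A *** idm (A ** B) in b y *.
set j := re2 (diagU A B) _ _ >>> u.
rewrite -!totA (totA _ (opcart K (mid_out A A B) _)) opcart_iso_map.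
have Hj : box_lunit M \o vert j =
  cart (bang A *** idm (A ** B)) _ \o cart (diagU A B) _.
  by rewrite /j vert_comp totA -Hu cart_re2.
have Hw : vert w \o r = cart (diagU A B) _ \o vert (iso_inv j).
  apply: (cartesian_cancel (cartesian_cart _ _)).
    by rewrite !base_comp !base_vert comp_idl comp_idr Er.
  by rewrite [RHS]totA -Hj -[RHS]totA vert_iso_inv comp_idr -Hr totA
    cart_box_re_l.
have Hy : vert y \o box_hom (opcart K (diag A) _) (tid M) =
    opcart K F _ \o vert w.
  rewrite /y vert_comp -opcart_iso_map -vert_box_push_l -totA.
  by rewrite (totA _ _ (opcart _ _ _)) vert_inv_iso comp_idl.
have Hyw : vert y \o (box_hom (opcart K (diag A) _) (tid M) \o r) =
    opcart K F _ \o (cart (diagU A B) _ \o vert (iso_inv j)).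
  by rewrite (totA (vert y)) Hy -totA Hw.
rewrite -!totA; set x := _ >>> iso_inv b.
have Hx : vert x \o s = opcart K (diagU A B) Q \o vert (iso_inv j).
  apply: (bc_transpose (q := sq_lu A B)).
    by rewrite base_vert comp_idr.
  transitivity (vert y \o (box_hom (opcart K (diag A) _) (tid M) \o r)); last
    exact: Hyw.
  by congr (_ \o _).
transitivity (vert j \o (vert (push_id K Q)
  \o (vert (push_eq K (out_diagU A B) Q)
  \o (vert (push_comp K (diagU A B) (mid_out A A B) Q)
  \o (opcart K (mid_out A A B) ((diagU A B)`! Q)
  \o (opcart K (diagU A B) Q \o vert (iso_inv j))))))).
  rewrite /j vert_iso_comp -totA.
  by do 6 congr (_ \o _).
rewrite (totA (opcart K (mid_out A A B) _)) (totA (vert (push_comp _ _ _ _))).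
rewrite vert_push_comp (totA (vert (push_eq _ _ _))) vert_push_eq.
by rewrite (totA _ (opcart K (idm (A ** B)) Q)) vert_push_id comp_idl
  vert_iso_inv.
Qed.

End Units.

End Composition.

(** * The spans that define the structural isomorphisms *)

(** Side conditions on the base are equations between maps of products. *)
Ltac tot_base :=
  rewrite ?(base_comp, base_box_hom, base_box_pair, base_cart, base_opcart,
    base_vert,
            base_id, base_alpha, base_unit_map);
  rewrite /mid_diag /mid_diag2 /mid_out /mid_out2 /diagL /diagR /outL /outR
          /diagU /diagU1 /diagU2 /prodA;
  prod_eq.

Section UniversalSpans.
Variables (S : fpcat) (C : indexed_smcat S) (K : indexed_coproducts C).
Local Notation total := (total_cat C).

Local Notation "f `!" := (push K f) (at level 2, format "f `!").
Local Notation "M ⊙ N" := ((mid_out _ _ _)`! ((mid_diag _ _ _)^* (M ⊠ N)))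
  (at level 34, no associativity).

Lemma cartesian_id (X : total) : cartesian (idm X).
Proof. by case: X => A M; exact: (invertible_bwd (re1 M)). Qed.

Lemma base_box_lunit (A : S) (M : C A) : base (box_lunit M) = << bang A, idm A >>.
Proof. by rewrite /box_lunit /unit_cart; tot_base. Qed.

Lemma base_box_runit (A : S) (M : C A) : base (box_runit M) = << idm A, bang A >>.
Proof. by rewrite /box_runit /unit_cart; tot_base. Qed.

Lemma cartesian_box_lunit (A : S) (M : C A) : cartesian (box_lunit M).
Proof.
apply: cartesian_comp; first by apply: cartesian_vert; exact: invertible_bwd.
apply: cartesian_box_pair; [exact: cartesian_unit_cart | exact: cartesian_id].
Qed.

Lemma cartesian_box_runit (A : S) (M : C A) : cartesian (box_runit M).
Proof.
apply: cartesian_comp; first by apply: cartesian_vert; exact: invertible_bwd.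
apply: cartesian_box_pair; [exact: cartesian_id | exact: cartesian_unit_cart].
Qed.

(** The maps in the characterization of the associator exist: they factor
    through cartesian maps. *)
Lemma odot_assoc_span (A B D E : S) (M : C (A ** B)) (N : C (B ** D))
  (P : C (D ** E)) (T := (mid_diag2 A B D E)^* (M ⊠ (N ⊠ P))) :
  exists (t : T ⇝ (((mid_diag A B D)^* (M ⊠ N)) ⊠ P))
  (s : T ⇝ ((mid_diag A D E)^* ((M ⊙ N) ⊠ P)))
  (t' : T ⇝ (M ⊠ ((mid_diag B D E)^* (N ⊠ P))))
  (s' : T ⇝ ((mid_diag A B E)^* (M ⊠ (N ⊙ P)))),
  (base t = diagL A B D E /\ base s = outL A B D E /\
   alpha M N P \o box_hom (cart (mid_diag A B D) (M ⊠ N)) (tid P) \o t =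
     cart (mid_diag2 A B D E) (M ⊠ (N ⊠ P)) /\
   cart (mid_diag A D E) ((M ⊙ N) ⊠ P) \o s =
     box_hom (opcart K (mid_out A B D) ((mid_diag A B D)^* (M ⊠ N))) (tid P)
       \o t) /\
  (base t' = diagR A B D E /\ base s' = outR A B D E /\
   box_hom (tid M) (cart (mid_diag B D E) (N ⊠ P)) \o t' =
     cart (mid_diag2 A B D E) (M ⊠ (N ⊠ P)) /\
   cart (mid_diag A B E) (M ⊠ (N ⊙ P)) \o s' =
     box_hom (tid M) (opcart K (mid_out B D E) ((mid_diag B D E)^* (N ⊠ P)))
       \o t') /\
  vert (odot_assoc K M N P) \o (opcart K (mid_out A D E) _ \o s) =
    opcart K (mid_out A B E) _ \o s' /\
  vert (bwd (odot_assoc K M N P)) \o (opcart K (mid_out A B E) _ \o s') =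
    opcart K (mid_out A D E) _ \o s.
Proof.
have [||t [Et Ht]] := @cartesian_lift S C (Tot T) _ _
    (alpha M N P \o box_hom (cart (mid_diag A B D) (M ⊠ N)) (tid P))
    (cart (mid_diag2 A B D E) (M ⊠ (N ⊠ P))) (diagL A B D E).
  apply: cartesian_comp; last exact: cartesian_alpha.
  by apply: cartesian_box_hom; [exact: cartesian_cart | exact: cartesian_id].
  by tot_base.
have [||s [Es Hs]] := @cartesian_lift S C (Tot T) _ _
    (cart (mid_diag A D E) ((M ⊙ N) ⊠ P))
    (box_hom (opcart K (mid_out A B D) ((mid_diag A B D)^* (M ⊠ N))) (tid P) \o t)
    (outL A B D E).
  exact: cartesian_cart.
  by rewrite base_comp Et; tot_base.
have [||t' [Et' Ht']] := @cartesian_lift S C (Tot T) _ _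
    (box_hom (tid M) (cart (mid_diag B D E) (N ⊠ P)))
    (cart (mid_diag2 A B D E) (M ⊠ (N ⊠ P))) (diagR A B D E).
  by apply: cartesian_box_hom; [exact: cartesian_id | exact: cartesian_cart].
  by tot_base.
have [||s' [Es' Hs']] := @cartesian_lift S C (Tot T) _ _
    (cart (mid_diag A B E) (M ⊠ (N ⊙ P)))
    (box_hom (tid M) (opcart K (mid_out B D E) ((mid_diag B D E)^* (N ⊠ P)))
      \o t')
    (outR A B D E).
  exact: cartesian_cart.
  by rewrite base_comp Et'; tot_base.
exists t, s, t', s'; do 2 (split; first by []).
exact: (odot_assoc_opcart Et Es Ht Hs Et' Es' Ht' Hs').
Qed.

Lemma odot_lunit_span (A B : S) (M : C (A ** B)) :
  exists (r : M ⇝ (((bang A)^* (U0 C)) ⊠ M))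
  (s : M ⇝ ((mid_diag A A B)^*
         (((diag A)`! ((bang A)^* (U0 C))) ⊠ M))),
  base r = diagU A B /\ base s = diagU A B /\
  box_hom (cart (bang A) (U0 C)) (tid M) \o r = box_lunit M /\
  cart (mid_diag A A B) _ \o s = box_hom (opcart K (diag A) _) (tid M) \o r /\
  vert (bwd (odot_lunit K M)) = opcart K (mid_out A A B) _ \o s.
Proof.
have [||r [Er Hr]] := @cartesian_lift S C (Tot M) _ _
    (box_hom (cart (bang A) (U0 C)) (tid M)) (box_lunit M) (diagU A B).
  by apply: cartesian_box_hom; [exact: cartesian_cart | exact: cartesian_id].
  by rewrite base_box_lunit; tot_base.
have [||s [Es Hs]] := @cartesian_lift S C (Tot M) _ _
    (cart (mid_diag A A B) (((diag A)`! ((bang A)^* (U0 C))) ⊠ M))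
    (box_hom (opcart K (diag A) _) (tid M) \o r) (diagU A B).
  exact: cartesian_cart.
  by rewrite base_comp Er; tot_base.
have E := odot_lunit_opcart Er Es Hr Hs.
exists r, s; do 4 (split; first by []).
rewrite -[LHS]comp_idr -E totA.
transitivity (tid (((diag A)`! ((bang A)^* (U0 C))) ⊙ M)
  \o (opcart K (mid_out A A B) _ \o s)); last exact: comp_idl.
by congr (_ \o _); exact: vert_iso.
Qed.

Lemma odot_runit_span (A B : S) (M : C (A ** B)) :
  exists (r : M ⇝ (M ⊠ ((bang B)^* (U0 C))))
  (s : M ⇝ ((mid_diag A B B)^*
         (M ⊠ ((diag B)`! ((bang B)^* (U0 C)))))),
  base r = diagU2 A B /\ base s = diagU1 A B /\
  box_hom (tid M) (cart (bang B) (U0 C)) \o r = box_runit M /\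
  cart (mid_diag A B B) _ \o s = box_hom (tid M) (opcart K (diag B) _) \o r /\
  vert (bwd (odot_runit K M)) = opcart K (mid_out A B B) _ \o s.
Proof.
have [||r [Er Hr]] := @cartesian_lift S C (Tot M) _ _
    (box_hom (tid M) (cart (bang B) (U0 C))) (box_runit M) (diagU2 A B).
  by apply: cartesian_box_hom; [exact: cartesian_id | exact: cartesian_cart].
  by rewrite base_box_runit; tot_base.
have [||s [Es Hs]] := @cartesian_lift S C (Tot M) _ _
    (cart (mid_diag A B B) (M ⊠ ((diag B)`! ((bang B)^* (U0 C)))))
    (box_hom (tid M) (opcart K (diag B) _) \o r) (diagU1 A B).
  exact: cartesian_cart.
  by rewrite base_comp Er; tot_base.
have E := odot_runit_opcart Er Es Hr Hs.
exists r, s; do 4 (split; first by []).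
rewrite -[LHS]comp_idr -E totA.
transitivity (tid (M ⊙ ((diag B)`! ((bang B)^* (U0 C))))
  \o (opcart K (mid_out A B B) _ \o s)); last exact: comp_idl.
by congr (_ \o _); exact: vert_iso.
Qed.

End UniversalSpans.

(** * Comparison of the triangle composites *)

Section HatAndCheck.
Variables (S : fpcat) (C : indexed_smcat S) (K : indexed_coproducts C).
Local Notation total := (total_cat C).

Local Notation "f `!" := (push K f) (at level 2, format "f `!").
Local Notation "M ⊙ N" := ((mid_out _ _ _)`! ((mid_diag _ _ _)^* (M ⊠ N)))
  (at level 34, no associativity).
Local Notation "1" := (one S).

Section Triangles.
Variables (A : S) (M N : C A) (X : C (1 ** A)).
Variables (n : X ⇝ N) (base_n : base n = p2).

Local Notation Mh := ((@p1 S A 1)^* M).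
Local Notation m := (@cart S C (A ** 1) A p1 M).
Local Notation dA := (mid_diag A 1 A).
Local Notation d1 := (mid_diag 1 A 1).
Local Notation opcD B := (opcart K (diag B) ((bang B)^* (U0 C))).

(** The internal tensor product as the reindexing of the external one along the
    diagonal. *)
Definition tens_box (L L' : C A) : (L ⊗ L') ⇝ (L ⊠ L') :=
  box_pair (tid L) (tid L').

Lemma cartesian_tens_box (L L' : C A) : cartesian (tens_box L L').
Proof. by apply: cartesian_box_pair; exact: cartesian_id. Qed.

(** The map [G] is the 2-cell [etab] transposed from the pushforward along the
    diagonal, and with its target moved from the composite to the apex of the
    span, which is isomorphic to it because the middle object is terminal. *)
Definition eta_rel (etab : (diag A)`! ((bang A)^* (U0 C)) ~> Mh ⊙ X)
  (eta : tunit (C A) ~> M ⊗ N) : Prop :=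
  exists G : ((bang A)^* (U0 C)) ⇝ (dA^* (Mh ⊠ X)),
    base G = << idm A, << bang A, idm A >> >> /\
    opcart K (mid_out A 1 A) _ \o G = vert etab \o opcD A /\
    box_hom m n \o (cart dA _ \o G) = tens_box M N \o vert
      (eta \o bwd (fmu0 (bang A)^* )).

Variable (y : (d1^* (X ⊠ Mh)) ⇝ (N ⊗ M)).
Variables (base_y : base y = p1 \o p2)
  (Hy : tens_box N M \o y = box_hom n m \o cart d1 (X ⊠ Mh)).
Variable (ups : ((diag 1)`! ((bang 1)^* (U0 C))) ⇝ (U0 C)).
Variable (Hups : ups \o opcD 1 = cart (bang 1) (U0 C)).

(** Both sides are maps to the unit object of the terminal fibre; [y] is the
    apex of the span of [X] and [hat M] compared with [N ⊗ M], and [ups] undoes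
    the pushforward along the diagonal of the terminal object. *)
Definition eps_rel (epsb : X ⊙ Mh ~> (diag 1)`! ((bang 1)^* (U0 C)))
  (eps : N ⊗ M ~> tunit (C A)) : Prop :=
  ups \o (vert epsb \o opcart K (mid_out 1 A 1) (d1^* (X ⊠ Mh)))
  = unit_cart C A \o (vert eps \o y).

(** Both composites are pushed to maps out of the apex of the threefold span.
    On the side of the bicategory [Hzr] expresses the triangle composite through
    the lift [u] of [M] to the apex, and [Hyu] identifies that lift with the
    unit of the fibre followed by its associator. *)
Lemma hat_triangle etab eta epsb eps :
  eta_rel etab eta -> eps_rel epsb eps ->
  m \o vert (odot_runit K Mh \o odot_map K (idm Mh) epsb \o odot_assoc K Mh X Mh
         \o odot_map K etab (idm Mh) \o bwd (odot_lunit K Mh)) =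
  vert (trunit M \o tmap (idm M) eps \o tassoc M N M \o tmap eta (idm M)
         \o bwd (tlunit M)) \o m.
Proof.
move=> [G [base_G [HG1 HG2]]] Heps.
have [t [s [t' [s' [[Et [Es [Ht Hs]]] [[Et' [Es' [Ht' Hs']]] [Has _]]]]]]] :=
  odot_assoc_span K Mh X Mh.
have [r [s0 [Er [Es0 [Hr [Hs0 Hl]]]]]] := odot_lunit_span K Mh.
have [r1 [s1 [Er1 [Es1 [Hr1 [Hs1 Hr']]]]]] := odot_runit_span K Mh.
pose H := cart dA (Mh ⊠ X) \o G.
(* [u] inserts the unit [G] next to its argument; on the base it duplicates the
   point of [A] *)
have [||u [Eu Hu]] := @cartesian_lift S C (Tot Mh) _ _
    (cart (mid_diag2 A 1 A 1) (Mh ⊠ (X ⊠ Mh)))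
    (alpha Mh X Mh \o (box_hom H (tid Mh) \o r))
    << p1, << bang (A ** 1), idm (A ** 1) >> >>.
  exact: cartesian_cart.
  by rewrite 2!base_comp base_alpha base_box_hom base_comp base_G Er; tot_base.
have Htu : t \o u = box_hom G (tid Mh) \o r.
  apply: (@cartesian_cancel S C _ _ _
    (alpha Mh X Mh \o box_hom (cart dA (Mh ⊠ X)) (tid Mh))).
    apply: cartesian_comp; last exact: cartesian_alpha.
    by apply: cartesian_box_hom; [exact: cartesian_cart | exact: cartesian_id].
    by rewrite !base_comp base_box_hom base_G Et Eu Er; tot_base.
  by rewrite totA Ht Hu -!totA (totA (box_hom _ _)) box_hom_comp comp_idl.
have Hsu : vert (fmap (mid_diag A A 1)^* (box_map etab (idm Mh))) \o s0 = s \o u.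
  apply: (cartesian_cancel (cartesian_cart (mid_diag A A 1) _)).
    by rewrite !base_comp base_vert comp_idl Es Es0 Eu; tot_base.
  rewrite totA cart_box_map -totA Hs0 totA box_hom_comp vert_id comp_idl -HG1.
  by rewrite totA Hs -totA Htu totA box_hom_comp comp_idl.
have Hch : opcart K (mid_out A 1 1) _ \o (s1 \o vert (odot_runit K Mh
      \o odot_map K (idm Mh) epsb \o odot_assoc K Mh X Mh
      \o odot_map K etab (idm Mh) \o bwd (odot_lunit K Mh))) =
    opcart K (mid_out A 1 1) _
      \o (vert (fmap (mid_diag A 1 1)^* (box_map (idm Mh) epsb)) \o (s' \o u)).
  (* opaque from here on, as [vert_comp] would also split these isomorphisms *)
  move: Has Hl Hr'.
  move: (odot_assoc K Mh X Mh) (odot_lunit K Mh) (odot_runit K Mh) => a l q.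
  rewrite /odot_unit /odot /box in a l q *; move=> Has Hl Hr'.
  rewrite totA -Hr' !vert_comp -!totA (totA (vert (bwd q))) vert_iso comp_idl Hl.
  rewrite (totA _ _ s0) opcart_odot_map -totA Hsu (totA _ s) (totA (vert a) _ u)
    Has.
  by rewrite -[X in _ \o X]totA (totA (vert _)) opcart_odot_map -totA.
move: Hch; set taub := _ \o bwd (odot_lunit K Mh).
move: taub => taub Hch {Has Hl Hr' Hsu Hs Ht Htu}.
(* the pushforward at the end runs along an isomorphism of the base, so it can
   be cancelled *)
have [||ho [_ [Ho _]]] := @opcart_inverse _ _ K _ _ (mid_out A 1 1)
    << p1, << bang (A ** 1), p2 >> >>
    ((mid_diag A 1 1)^* (Mh ⊠ ((diag 1)`! ((bang 1)^* (U0 C))))).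
  by tot_base.
  by tot_base.
have Hz : s1 \o vert taub =
    vert (fmap (mid_diag A 1 1)^* (box_map (idm Mh) epsb)) \o (s' \o u).
  by have := f_equal (comp ho) Hch; rewrite !(totA ho) Ho !comp_idl.
have Hzr : box_runit Mh \o vert taub =
    box_hom (tid Mh) (unit_cart C A \o (vert eps \o y)) \o (t' \o u).
  rewrite -Hr1 -Hups -[X in box_hom X _]comp_idl -box_hom_comp -2!totA
    (totA (box_hom _ _) r1).
  rewrite -Hs1 -(totA _ s1) Hz (totA _ _ (s' \o u)) cart_box_map
    -(totA _ _ (s' \o u)).
  rewrite (totA _ s') Hs' -(totA _ t') (totA (box_hom (vert _) _)) box_hom_comp
    totA box_hom_comp.
  by rewrite vert_id !comp_idl Heps.
have Hyu : box_hom m y \o (t' \o u) =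
    tens_box M (N ⊗ M) \o (vert (tassoc M N M \o tmap eta (idm M) \o bwd
      (tlunit M)) \o m).
  apply: (@cartesian_cancel S C _ _ _ (box_hom (tid M) (tens_box N M))).
    by apply: cartesian_box_hom; [exact: cartesian_id |
      exact: cartesian_tens_box].
    by rewrite !base_comp base_box_hom base_y Et' Eu /tens_box; tot_base.
  have Hr0 : box_hom (vert (bwd (fmu0 (bang A)^* ))) m \o r =
      tens_box (tunit (C A)) M \o (vert (bwd (tlunit M)) \o m).
    apply: (@cartesian_cancel S C _ _ _ (box_hom (unit_cart C A) (tid M))).
      by apply: cartesian_box_hom; [exact: cartesian_unit_cart |
        exact: cartesian_id].
      by rewrite !base_comp base_box_hom Er /tens_box; tot_base.
    rewrite !(totA (box_hom (unit_cart C A) _)) box_hom_comp unit_cart_cart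
      /tens_box box_hom_box_pair.
    rewrite !comp_idl !comp_idr (totA (box_pair _ _)) -/(box_lunit M)
      -box_lunit_nat -Hr.
    by rewrite totA box_hom_comp comp_idl comp_idr.
  rewrite !(totA (box_hom (tid M) _)) box_hom_comp comp_idl Hy
    -[X in box_hom X _]comp_idr.
  rewrite -box_hom_comp -totA (totA _ t') Ht' Hu (totA (box_hom m _)) -alpha_nat
    -totA.
  rewrite (totA (box_hom _ m)) box_hom_comp /H HG2 comp_idr !vert_comp.
  rewrite -[X in box_hom _ X]comp_idl -totA -box_hom_comp -totA (totA _ _ r).
  have -> : box_hom (vert eta \o vert (bwd (fmu0 (bang A)^* ))) m =
      box_hom (vert eta) (tid M) \o box_hom (vert (bwd (fmu0 (bang A)^* ))) m.
    by rewrite box_hom_comp comp_idl.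
  have Ed : box_pair (tens_box M N \o vert eta) (tid M) =
      box_pair (tens_box M N) (tid M) \o vert (tmap eta (idm M)).
    by rewrite box_pair_vert vert_id comp_idr.
  rewrite -!(totA _ _ r) Hr0 {2 3}/tens_box !(totA (box_hom _ _)) box_hom_comp
    !(totA (box_hom _ _)) !box_hom_box_pair.
  rewrite !comp_idl !comp_idr Ed -(totA (box_pair _ _)) (totA (alpha _ _ _))
    tassoc_box_pair.
  by rewrite -!totA.
apply: (cartesian_cancel (cartesian_box_runit M)).
  by rewrite !base_comp !base_vert comp_idl comp_idr.
rewrite totA -box_runit_nat -totA Hzr (totA (box_hom _ _) (box_hom _ _))
  box_hom_comp comp_idr comp_idl.
rewrite (totA (unit_cart C A)) -[X in box_hom X _]comp_idl -box_hom_comp -totA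
  Hyu.
rewrite !vert_comp -!totA /tens_box (totA (box_hom _ _)) box_hom_box_pair
  !comp_idr.
rewrite (totA (vert (bwd (trunit M)))) vert_iso comp_idl.
by rewrite (totA (box_pair _ _) (vert (tmap _ _))) box_pair_vert vert_id comp_idl.
Qed.

(** The mirror image of [hat_triangle]: the unit acts on the right and the counit
    on the left, and the associator is used backwards. *)
Lemma check_triangle etab eta epsb eps :
  eta_rel etab eta -> eps_rel epsb eps ->
  n \o vert (odot_lunit K X \o odot_map K epsb (idm X)
         \o bwd (odot_assoc K X Mh X)
         \o odot_map K (idm X) etab \o bwd (odot_runit K X)) =
  vert (tlunit N \o tmap eps (idm N) \o bwd (tassoc N M N) \o tmap (idm N) eta
         \o bwd (trunit N)) \o n.
Proof.
move=> [G [base_G [HG1 HG2]]] Heps.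
have [t [s [t' [s' [[Et [Es [Ht Hs]]] [[Et' [Es' [Ht' Hs']]] [_ Has]]]]]]] :=
  odot_assoc_span K X Mh X.
have [r [s0 [Er [Es0 [Hr [Hs0 Hl]]]]]] := odot_runit_span K X.
have [r1 [s1 [Er1 [Es1 [Hr1 [Hs1 Hr']]]]]] := odot_lunit_span K X.
pose H := cart dA (Mh ⊠ X) \o G.
(* [u] inserts the unit [G] next to its argument; on the base it duplicates the
   point of [A] *)
have [||u [Eu Hu]] := @cartesian_lift S C (Tot X) _ _
    (cart (mid_diag2 1 A 1 A) (X ⊠ (Mh ⊠ X)))
    (box_hom (tid X) H \o r) << p1, << p2, idm (1 ** A) >> >>.
  exact: cartesian_cart.
  by rewrite base_comp base_box_hom base_comp base_G Er; tot_base.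
have Htu : t' \o u = box_hom (tid X) G \o r.
  apply: (@cartesian_cancel S C _ _ _ (box_hom (tid X) (cart dA (Mh ⊠ X)))).
    by apply: cartesian_box_hom; [exact: cartesian_id | exact: cartesian_cart].
    by rewrite !base_comp base_box_hom base_G Et' Eu Er; tot_base.
  by rewrite totA Ht' Hu (totA (box_hom _ _)) box_hom_comp comp_idl.
have Hsu : vert (fmap (mid_diag 1 A A)^* (box_map (idm X) etab)) \o s0 = s' \o u.
  apply: (cartesian_cancel (cartesian_cart (mid_diag 1 A A) _)).
    by rewrite !base_comp base_vert comp_idl Es' Es0 Eu; tot_base.
  rewrite totA cart_box_map -totA Hs0 totA box_hom_comp vert_id comp_idl -HG1.
  by rewrite totA Hs' -totA Htu totA box_hom_comp comp_idl.
have Hch : opcart K (mid_out 1 1 A) _ \o (s1 \o vert (odot_lunit K X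
      \o odot_map K epsb (idm X) \o bwd (odot_assoc K X Mh X)
      \o odot_map K (idm X) etab \o bwd (odot_runit K X))) =
    opcart K (mid_out 1 1 A) _
      \o (vert (fmap (mid_diag 1 1 A)^* (box_map epsb (idm X))) \o (s \o u)).
  (* opaque from here on, as [vert_comp] would also split these isomorphisms *)
  move: Has Hl Hr'.
  move: (odot_assoc K X Mh X) (odot_runit K X) (odot_lunit K X) => a l q.
  rewrite /odot_unit /odot /box in a l q *; move=> Has Hl Hr'.
  rewrite totA -Hr' !vert_comp -!totA (totA (vert (bwd q))) vert_iso comp_idl Hl.
  rewrite (totA _ _ s0) opcart_odot_map -totA Hsu (totA _ s')
    (totA (vert (bwd a)) _ u) Has.
  by rewrite -[X in _ \o X]totA (totA (vert _)) opcart_odot_map -totA.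
move: Hch; set taub := _ \o bwd (odot_runit K X).
move: taub => taub Hch {Has Hl Hr' Hsu Hs' Ht' Htu}.
(* the pushforward at the end runs along an isomorphism of the base, so it can
   be cancelled *)
have [||ho [_ [Ho _]]] := @opcart_inverse _ _ K _ _ (mid_out 1 1 A)
    << p1, idm (1 ** A) >>
    ((mid_diag 1 1 A)^* (((diag 1)`! ((bang 1)^* (U0 C))) ⊠ X)).
  by tot_base.
  by tot_base.
have Hz : s1 \o vert taub =
    vert (fmap (mid_diag 1 1 A)^* (box_map epsb (idm X))) \o (s \o u).
  by have := f_equal (comp ho) Hch; rewrite !(totA ho) Ho !comp_idl.
have Hzr : box_lunit X \o vert taub =
    box_hom (unit_cart C A \o (vert eps \o y)) (tid X) \o (t \o u).
  rewrite -Hr1 -Hups -[X in box_hom _ X]comp_idl -box_hom_comp -2!totA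
    (totA (box_hom _ _) r1).
  rewrite -Hs1 -(totA _ s1) Hz (totA _ _ (s \o u)) cart_box_map
    -(totA _ _ (s \o u)).
  rewrite (totA _ s) Hs -(totA _ t) (totA (box_hom (vert _) _)) box_hom_comp totA
    box_hom_comp.
  by rewrite vert_id !comp_idl Heps.
have Hyu : box_hom y n \o (t \o u) =
    tens_box (N ⊗ M) N
      \o (vert (bwd (tassoc N M N) \o tmap (idm N) eta \o bwd (trunit N)) \o n).
  apply: (@cartesian_cancel S C _ _ _ (alpha N M N \o box_hom (tens_box N M)
    (tid N))).
    apply: cartesian_comp; last exact: cartesian_alpha.
    by apply: cartesian_box_hom; [exact: cartesian_tens_box |
      exact: cartesian_id].
    rewrite !base_comp base_box_hom base_y Et Eu base_n /tens_box base_box_pair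
      !base_id.
    by rewrite base_vert; tot_base.
  have Hr0 : box_hom n (vert (bwd (fmu0 (bang A)^* ))) \o r =
      tens_box N (tunit (C A)) \o (vert (bwd (trunit N)) \o n).
    apply: (@cartesian_cancel S C _ _ _ (box_hom (tid N) (unit_cart C A))).
      by apply: cartesian_box_hom; [exact: cartesian_id |
        exact: cartesian_unit_cart].
      by rewrite !base_comp base_box_hom base_n Er /tens_box; tot_base.
    rewrite !(totA (box_hom _ (unit_cart C A))) box_hom_comp unit_cart_cart
      /tens_box box_hom_box_pair.
    rewrite !comp_idl !comp_idr (totA (box_pair _ _)) -/(box_runit N)
      -box_runit_nat -Hr.
    by rewrite totA box_hom_comp comp_idl comp_idr.
  have Ed : box_pair (tid N) (tens_box M N \o vert eta) =
      box_pair (tid N) (tens_box M N) \o vert (tmap (idm N) eta).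
    by rewrite box_pair_vert vert_id comp_idr.
  have Etu : alpha X Mh X \o (box_hom (cart d1 (X ⊠ Mh)) (tid X) \o (t \o u)) =
      box_hom (tid X) H \o r.
    by rewrite (totA (alpha _ _ _)) (totA _ t) Ht Hu.
  have En : box_hom (box_hom n m \o cart d1 (X ⊠ Mh)) n =
      box_hom (box_hom n m) n \o box_hom (cart d1 (X ⊠ Mh)) (tid X).
    by rewrite box_hom_comp comp_idr.
  have Ee : box_hom n (tens_box M N \o vert (eta \o bwd (fmu0 (bang A)^* ))) =
      box_hom (tid N) (tens_box M N \o vert eta) \o box_hom n
        (vert (bwd (fmu0 (bang A)^* ))).
    by rewrite box_hom_comp comp_idl vert_comp totA.
  rewrite -2!(totA (alpha _ _ _)) !(totA (box_hom (tens_box N M) _)) box_hom_comp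
    comp_idl Hy En.
  rewrite -(totA (box_hom (box_hom n m) n)) (totA (alpha _ _ _)) alpha_nat.
  rewrite -(totA (box_hom n _)) Etu (totA (box_hom n _)) box_hom_comp comp_idr
    HG2 Ee.
  rewrite -(totA _ _ r) Hr0.
  rewrite /tens_box (totA (box_hom _ _)) !box_hom_box_pair !comp_idl !comp_idr Ed.
  rewrite (totA (alpha _ _ _)) tassoc_box_pair !vert_comp.
  by rewrite -!totA (totA (vert (tassoc N M N))) vert_iso' comp_idl.
apply: (cartesian_cancel (cartesian_box_lunit N)).
  by rewrite !base_comp !base_vert comp_idl comp_idr.
rewrite totA -box_lunit_nat -totA Hzr (totA (box_hom _ _) (box_hom _ _))
  box_hom_comp comp_idr comp_idl.
rewrite (totA (unit_cart C A)) -[X in box_hom _ X]comp_idl -box_hom_comp -totA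
  Hyu.
rewrite !vert_comp -!totA /tens_box (totA (box_hom _ _)) box_hom_box_pair
  !comp_idr.
rewrite (totA (vert (bwd (tlunit N)))) vert_iso comp_idl.
by rewrite (totA (box_pair _ _) (vert (tmap _ _))) box_pair_vert vert_id comp_idl.
Qed.

End Triangles.

End HatAndCheck.

(** * Comparison of the duality data *)

Section RightDuals.
Variables (S : fpcat) (C : indexed_smcat S) (K : indexed_coproducts C).
Local Notation total := (total_cat C).

Local Notation "f `!" := (push K f) (at level 2, format "f `!").
Local Notation "M ⊙ N" := ((mid_out _ _ _)`! ((mid_diag _ _ _)^* (M ⊠ N)))
  (at level 34, no associativity).
Local Notation "1" := (one S).

Section Correspondence.
Variables (A : S) (M N : C A) (X : C (1 ** A)).
Variables (n : X ⇝ N) (n' : N ⇝ X).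
Variables (base_n : base n = p2) (base_n' : base n' = << bang A, idm A >>).
Variables (n'n : n' \o n = tid X) (nn' : n \o n' = tid N).

Local Notation Mh := ((@p1 S A 1)^* M).
Local Notation m := (@cart S C (A ** 1) A p1 M).
Local Notation dA := (mid_diag A 1 A).
Local Notation d1 := (mid_diag 1 A 1).
Local Notation opcD B := (opcart K (diag B) ((bang B)^* (U0 C))).

Lemma cart_p1_inverse : exists m' : M ⇝ Mh,
  base m' = << idm A, bang A >> /\ m' \o m = tid Mh /\ m \o m' = tid M.
Proof.
by apply: (cartesian_inverse (cartesian_cart (@p1 S A 1) M)); rewrite base_cart;
  tot_base.
Qed.

(** Remove the pushforwards, of which the one over the terminal middle object is
    invertible, and factor through the cartesian map [tens_box]. *)
Lemma eta_rel_of_hat (etab : (diag A)`! ((bang A)^* (U0 C)) ~> Mh ⊙ X) :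
  exists eta, eta_rel n etab eta.
Proof.
have [||q [Eq [Hq1 Hq2]]] := @opcart_inverse _ _ K _ _ (mid_out A 1 A)
    << p1, << bang (A ** A), p2 >> >> (dA^* (Mh ⊠ X)).
  by tot_base.
  by tot_base.
have [G [EG HG]] : exists G : ((bang A)^* (U0 C)) ⇝ (dA^* (Mh ⊠ X)),
    base G = << idm A, << bang A, idm A >> >> /\
    opcart K (mid_out A 1 A) _ \o G = vert etab \o opcD A.
  exists (q \o (vert etab \o opcD A)).
  by rewrite !base_comp Eq totA Hq2 comp_idl; split=> //; tot_base.
have [||l [El Hl]] := @cartesian_lift S C _ _ _ (tens_box M N)
    (box_hom m n \o (cart dA _ \o G) \o vert (fmu0 (bang A)^* )) (idm A).
  exact: cartesian_tens_box.
  by rewrite !base_comp EG base_box_hom base_n /tens_box; tot_base.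
have [eta Eeta] := vert_of El; exists eta, G; split=> //; split=> //.
by rewrite vert_comp -Eeta (totA (tens_box M N)) Hl -(totA _ _ (vert _))
  vert_iso' comp_idr.
Qed.

Lemma eta_rel_of_dual (eta : tunit (C A) ~> M ⊗ N) :
  exists etab, eta_rel (K := K) n etab eta.
Proof.
have [m' [Em' [m'm mm']]] := cart_p1_inverse.
have [||G [EG HG]] := @cartesian_lift S C _ _ _ (cart dA (Mh ⊠ X))
    (box_hom m' n' \o (tens_box M N \o vert (eta \o bwd (fmu0 (bang A)^* ))))
    << idm A, << bang A, idm A >> >>.
  exact: cartesian_cart.
  by rewrite !base_comp base_box_hom base_n' Em' /tens_box; tot_base.
have [|h [Eh Hh]] := @opcart_univ _ _ K _ _ (diag A) ((bang A)^* (U0 C)) _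
    (opcart K (mid_out A 1 A) _ \o G) (idm (A ** A)).
  by rewrite base_comp EG; tot_base.
have [etab Eetab] := vert_of Eh; exists etab, G; split=> //; split.
  by rewrite -Eetab Hh.
by rewrite HG (totA (box_hom m n)) box_hom_comp mm' nn' box_hom_id comp_idl.
Qed.

Lemma hat_counit_iso : exists (y : (d1^* (X ⊠ Mh)) ⇝ (N ⊗ M))
    (y' : (N ⊗ M) ⇝ (d1^* (X ⊠ Mh))),
  (base y = p1 \o p2 /\ tens_box N M \o y = box_hom n m \o cart d1 (X ⊠ Mh)) /\
  (y' \o y = idm _ /\ y \o y' = idm _).
Proof.
have [m' [Em' [m'm mm']]] := cart_p1_inverse.
have [||y [Ey Hy]] := @cartesian_lift S C _ _ _ (tens_box N M)
    (box_hom n m \o cart d1 (X ⊠ Mh)) (p1 \o p2).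
  exact: cartesian_tens_box.
  by rewrite !base_comp base_box_hom base_n /tens_box; tot_base.
have [||y' [Ey' Hy']] := @cartesian_lift S C _ _ _ (cart d1 (X ⊠ Mh))
    (box_hom n' m' \o tens_box N M) << bang A, << idm A, bang A >> >>.
  exact: cartesian_cart.
  by rewrite !base_comp base_box_hom base_n' Em' /tens_box; tot_base.
exists y, y'; split=> //; split.
  apply: (cartesian_cancel (cartesian_cart d1 (X ⊠ Mh))).
    by rewrite base_comp Ey Ey' base_id; tot_base.
  by rewrite totA Hy' -totA Hy (totA (box_hom n' m')) box_hom_comp m'm n'n
    box_hom_id comp_idl comp_idr.
apply: (cartesian_cancel (cartesian_tens_box N M)).
  by rewrite base_comp Ey Ey' base_id; tot_base.
by rewrite totA Hy -totA Hy' (totA (box_hom n m)) box_hom_comp mm' nn' box_hom_id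
  comp_idl comp_idr.
Qed.

Lemma unit_one_iso :
  exists (ups : ((diag 1)`! ((bang 1)^* (U0 C))) ⇝ (U0 C))
    (ups' : (U0 C) ⇝ ((diag 1)`! ((bang 1)^* (U0 C)))),
  ups \o opcD 1 = cart (bang 1) (U0 C) /\ ups \o ups' = idm _.
Proof.
have [||h [_ [Hh1 Hh2]]] := @opcart_inverse _ _ K _ _ (diag 1) p1
    ((bang 1)^* (U0 C)).
  by tot_base.
  by tot_base.
have [||c [_ [_ Hc]]] := @cartesian_inverse _ _ _ _ (cart (bang 1) (U0 C)) (idm 1)
  (cartesian_cart _ _).
  exact: bang_uniq.
  exact: bang_uniq.
exists (cart (bang 1) (U0 C) \o h), (opcD 1 \o c).
by rewrite -totA Hh1 comp_idr -totA (totA h) Hh1 comp_idl.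
Qed.

(** The isomorphism may join two different fibres; this is what relates triangle
    identities over [A ** one] or [one ** A] to triangle identities over [A]. *)
Lemma conjugate_idm (B D : S) (L : C B) (L' : C D)
  (h : L ⇝ L') (h' : L' ⇝ L)
  (a : L ~> L) (b : L' ~> L') :
  h' \o h = tid L -> h \o h' = tid L' -> h \o vert a = vert b \o h ->
  a = idm L <-> b = idm L'.
Proof.
move=> H1 H2 E; split=> Ei; apply: vert_inj; rewrite vert_id.
  by rewrite -[LHS]comp_idr -H2 totA -E Ei vert_id comp_idr.
by rewrite -[LHS]comp_idl -H1 -totA E Ei vert_id comp_idl.
Qed.

(** The isomorphism [n] over [one ** A ~ A] says that [N] corresponds to [X]. It
    is kept arbitrary because in one direction of the theorem [X] is built from
    [N], and in the other [N] is built from [X]. *)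
Lemma hat_dual_iff : is_right_dual (hat K M) X <-> is_dual M N.
Proof.
have [y [y' [[Ey Hy] [Hy1 Hy2]]]] := hat_counit_iso.
have [ups [ups' [Hu1 Hu2]]] := unit_one_iso.
have [m' [_ [m'm mm']]] := cart_p1_inverse.
split.
  move=> [etab [epsb [T1 T2]]].
  have [eta Heta] := eta_rel_of_hat etab.
  have [||l [El Hl]] := @cartesian_lift S C _ _ _ (unit_cart C A)
      (ups \o (vert epsb \o (opcart K (mid_out 1 A 1) _ \o y'))) (idm A).
    exact: cartesian_unit_cart.
    exact: bang_uniq.
  have [eps Eeps] := vert_of El.
  have Heps : eps_rel y ups epsb eps.
    by rewrite /eps_rel -Eeps (totA (unit_cart C A)) Hl -!totA Hy1 comp_idr.
  exists eta, eps; split.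
    exact: (proj1 (conjugate_idm m'm mm' (hat_triangle Ey Hy Hu1 Heta Heps)) T1).
  exact: (proj1 (conjugate_idm n'n nn' (check_triangle base_n Ey Hy Hu1 Heta
    Heps)) T2).
move=> [eta [eps [T1 T2]]].
have [etab Heta] := eta_rel_of_dual eta.
have [|h [Eh Hh]] := @opcart_univ _ _ K _ _ (mid_out 1 A 1) _ _
    (ups' \o (unit_cart C A \o (vert eps \o y))) (idm (1 ** 1)).
  by apply: pair_ext; exact: bang_uniq.
have [epsb Eepsb] := vert_of Eh.
have Heps : eps_rel y ups epsb eps.
  by rewrite /eps_rel -Eepsb Hh totA Hu2 comp_idl.
exists etab, epsb; split.
  exact: (proj2 (conjugate_idm m'm mm' (hat_triangle Ey Hy Hu1 Heta Heps)) T1).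
exact: (proj2 (conjugate_idm n'n nn' (check_triangle base_n Ey Hy Hu1 Heta Heps))
  T2).
Qed.

End Correspondence.

Lemma iso_of_vert (A : S) (M N : C A) (h : M ⇝ N)
  (h' : N ⇝ M) :
  base h = idm A -> base h' = idm A -> h' \o h = tid M -> h \o h' = tid N ->
  inhabited (iso M N).
Proof.
move=> /vert_of [u ->] /vert_of [v ->] H1 H2; constructor;
  apply: (@Iso _ _ _ u v).
  by apply: vert_inj; rewrite vert_comp vert_id.
by apply: vert_inj; rewrite vert_comp vert_id.
Qed.

Lemma check_cart_inverse (A : S) (N : C A) :
  exists n' : N ⇝ ((@p2 S 1 A)^* N),
  base n' = << bang A, idm A >> /\ n' \o cart p2 N = tid _ /\
  cart p2 N \o n' = tid N.
Proof.
by apply: (cartesian_inverse (cartesian_cart (@p2 S 1 A) N)); rewrite base_cart;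
  tot_base.
Qed.

Lemma uncheck_cart_inverse (A : S) (X : C (1 ** A)) :
  exists n : X ⇝ (<< bang A, idm A >>^* X),
  base n = p2 /\ n \o cart << bang A, idm A >> X = tid _ /\
  cart << bang A, idm A >> X \o n = tid X.
Proof.
by apply: (cartesian_inverse (cartesian_cart << bang A, idm A >> X));
  rewrite base_cart; tot_base.
Qed.

Lemma hat_check_dual (A : S) (M N : C A) :
  is_dual M N -> is_right_dual (hat K M) (check K N).
Proof.
have [n' [En' [H1 H2]]] := check_cart_inverse N.
exact: (proj2 (hat_dual_iff M (base_cart p2 N) En' H1 H2)).
Qed.

Lemma hat_dual_uncheck (A : S) (M : C A) (X : C (1 ** A)) :
  is_right_dual (hat K M) X -> is_dual M (<< bang A, idm A >>^* X).
Proof.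
have [n [En [H1 H2]]] := uncheck_cart_inverse X.
exact: (proj1 (hat_dual_iff M En (base_cart _ X) H2 H1)).
Qed.

Lemma check_uncheck (A : S) (N : C A) (X : C (1 ** A)) :
  iso (<< bang A, idm A >>^* X) N -> inhabited (iso X (p2^* N)).
Proof.
move=> i.
have [n' [En' [H1 H2]]] := check_cart_inverse N.
have [n [En [H3 H4]]] := uncheck_cart_inverse X.
apply: (@iso_of_vert _ _ _ (n' \o (vert i \o n))
  (cart << bang A, idm A >> X \o (vert (bwd i) \o cart p2 N))).
  by rewrite !base_comp En' En; tot_base.
  by tot_base.
  rewrite -!totA (totA (cart p2 N)) H2 comp_idl (totA (vert (bwd i))) vert_iso.
  by rewrite comp_idl H4.
rewrite -!totA (totA n) H3 comp_idl (totA (vert i)) vert_iso'.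
by rewrite comp_idl H1.
Qed.

End RightDuals.

Theorem theorem6p1 (S : fpcat) (C : indexed_smcat S)
  (K : indexed_coproducts C) (A : S) (M : C A) :
  (dualizable M <-> right_dualizable (hat K M)) /\
  (forall N : C A, is_dual M N ->
     is_right_dual (hat K M) (check K N) /\
     (forall X : cell1 (b := bicat_over K) (one S) A,
        is_right_dual (hat K M) X -> inhabited (iso X (check K N)))).
Proof.
split; first split.
  by move=> [N H]; exists (check K N); exact: hat_check_dual.
  by move=> [X H]; exists (re C << bang A, idm A >> X); exact: hat_dual_uncheck H.
move=> N HN; split; first exact: hat_check_dual.
move=> X HX.
have [i] := dual_unique (hat_dual_uncheck HX) HN.
exact: check_uncheck i.
Qed.
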